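(* Let $K$ be a field and let $\mathcal{G}=(G^0,\mathcal{G}^1,r,s)$ be an ultragraph without sinks. Then the assignment $\pi_{\mathcal G}: L_K(\mathcal{G})\to A_K(\mathfrak{G}_{\mathcal G})$ given by $$\pi_{\mathcal G}(p_A)=1_{\mathcal{A}(A,A)},\qquad \pi_{\mathcal G}(s_e)=1_{\mathcal{A}((e,r(e)),\,r(e))},\qquad \pi_{\mathcal G}(s_e^* )=1_{\mathcal{A}(r(e),\,(e,r(e)))}$$ for all $A\in\mathcal{G}^0$ and $e\in\mathcal{G}^1$ extends to an isomorphism of $\mathbb{Z}$-graded $K$-algebras from the ultragraph Leavitt path algebra $L_K(\mathcal G)$ onto the Steinberg algebra $A_K(\mathfrak{G}_{\mathcal G})$ of the ultragraph groupoid.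
   Context: Ultragraphs. An ultragraph $\mathcal{G}=(G^0,\mathcal{G}^1,r,s)$ consists of a countable set $G^0$ of vertices, a countable set $\mathcal{G}^1$ of edges, and maps $s:\mathcal{G}^1\to G^0$, $r:\mathcal{G}^1\to\mathcal{P}(G^0)\setminus\{\varnothing\}$. A vertex $v$ is a sink if $s^{-1}(v)=\varnothing$, and regular if $0<|s^{-1}(v)|<\infty$. $\mathcal{G}^0$ is the smallest subset of $\mathcal{P}(G^0)$ containing all $\{v\}$ ($v\in G^0$) and all $r(e)$ ($e\in\mathcal{G}^1$) and closed under finite unions and finite intersections. A finite path is either an element $A\in\mathcal{G}^0$ (length $0$, $s(A)=r(A)=A$) or a sequence $\alpha=e_1\cdots e_n$ of edges with $s(e_{i+1})\in r(e_i)$ (length $|\alpha|=n$, $s(\alpha)=s(e_1)$, $r(\alpha)=r(e_n)$); $\mathcal{G}^*$ is the set of finite paths. An infinite path is a sequence $e_1e_2\cdots$ of edges with $s(e_{i+1})\in r(e_i)$ for all $i$, with source $s(e_1)$; $\mathfrak{p}^\infty$ is the set of infinite paths. Leavitt path algebra. $L_K(\mathcal{G})$ is the $K$-algebra generated by $\{s_e,s_e^*: e\in\mathcal{G}^1\}\cup\{p_A: A\in\mathcal{G}^0\}$ subject to, for all $A,B\in\mathcal{G}^0$, $e,f\in\mathcal{G}^1$: (1) $p_\varnothing=0$, $p_Ap_B=p_{A\cap B}$, $p_{A\cup B}=p_A+p_B-p_{A\cap B}$; (2) $p_{s(e)}s_e=s_e=s_ep_{r(e)}$ and $p_{r(e)}s_e^*=s_e^*=s_e^*p_{s(e)}$;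 (3) $s_e^*s_f=\delta_{e,f}p_{r(e)}$; (4) $p_v=\sum_{s(e)=v}s_es_e^*$ for every regular vertex $v$ (with $p_v:=p_{\{v\}}$). Put $s_A:=s_A^*:=p_A$ for $A\in\mathcal G^0$, and $s_\alpha=s_{e_1}\cdots s_{e_n}$, $s_\alpha^*=s_{e_n}^*\cdots s_{e_1}^*$ for $\alpha=e_1\cdots e_n$. It is $\mathbb{Z}$-graded with $L_K(\mathcal{G})_n=\mathrm{span}_K\{s_\alpha p_A s_\beta^*: \alpha,\beta\in\mathcal{G}^*, A\in\mathcal{G}^0, |\alpha|-|\beta|=n\}$. Ultrapaths. For $n\ge1$ let $\mathfrak{p}^n=\{(\alpha,A):\alpha\in\mathcal{G}^*,|\alpha|=n,A\in\mathcal{G}^0,A\subseteq r(\alpha)\}$, $\mathfrak{p}^0=\mathcal{G}^0$, $\mathfrak{p}=\bigsqcup_{n\ge0}\mathfrak{p}^n$; set $|(\alpha,A)|=|\alpha|$, $r((\alpha,A))=A$, $s((\alpha,A))=s(\alpha)$, and $r(A)=s(A)=A$ for $A\in\mathcal{G}^0$. An edge $e$ is identified with $(e,r(e))$. Products: $(\alpha,A)\cdot(\beta,B)=(\alpha\beta,B)$ if $s(\beta)\in A$; for $A,B\in\mathcal{G}^0$, $A\cdot B=A\cap B$ if this is nonempty; $A\cdot(\beta,B)=(\beta,B)$ if $s(\beta)\in A$; $(\alpha,A)\cdot B=(\alpha,A\cap B)$ if $A\cap B\neq\varnothing$; for $\gamma\in\mathfrak{p}^\infty$, $(\alpha,A)\cdot\gamma=\alpha\gamma$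 and $A\cdot\gamma=\gamma$ if $s(\gamma)\in A$; otherwise the product is undefined. A filter in $\mathcal{G}^0$ is a subset of $\mathcal{G}^0$ not containing $\varnothing$, closed under intersections and under supersets in $\mathcal{G}^0$; an ultrafilter is a filter not properly contained in any filter. $A\in\mathcal{G}^0$ is an ultraset if $\{B\in\mathcal{G}^0: A\subseteq B\}$ is an ultrafilter. A set $A$ emits the edges $e$ with $s(e)\in A$. Ultragraph groupoid ($\mathcal{G}$ without sinks). $Y_\infty=\{y\in\mathfrak{p}: r(y)\text{ is an ultraset emitting infinitely many edges}\}$, $X_{\mathcal G}=Y_\infty\cup\mathfrak{p}^\infty$, and $\mathfrak{G}_{\mathcal G}=\{(x\cdot\mu,|x|-|y|,y\cdot\mu): x,y\in\mathfrak{p},\ \mu\in X_{\mathcal G},\ r(x)=r(y),\ x\cdot\mu,y\cdot\mu\in X_{\mathcal G}\}$, with range $r(a,k,b)=(a,0,a)$, source $s(a,k,b)=(b,0,b)$, composition $(a,k,b)(b,l,c)=(a,k+l,c)$ and inverse $(a,k,b)^{-1}=(b,-k,a)$. The unit space is $\{(\mu,0,\mu):\mu\in X_{\mathcal G}\}$. For $x,y\in\mathfrak{p}$ with $r(x)=r(y)$ put $\mathcal{A}(x,y)=\{(x\cdot\mu,|x|-|y|,y\cdot\mu):\mu\in X_{\mathcal G},\ x\cdot\mu,y\cdot\mu\in X_{\mathcal G}\}$, and for a finite set $F$ of edges emitted by $r(x)$ and a finite $Q\subseteq\mathcal{G}^0$ put $\mathcal{A}(x,y,F,Q)=\mathcal{A}(x,y)\setminus(\bigcup_{e\in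 F}\mathcal{A}(x\cdot e,y\cdot e)\cup\bigcup_{C\in Q}\mathcal{A}(x\cdot C,y\cdot C))$ (undefined terms are empty). The topology on $\mathfrak{G}_{\mathcal G}$ has the sets $\mathcal{A}(x,y,F,Q)$ as a basis; the paper quotes from Marrero–Muhly that these are compact open bisections and that $\mathfrak{G}_{\mathcal G}$ is a Hausdorff ample groupoid. The $\mathbb{Z}$-grading of $\mathfrak{G}_{\mathcal G}$ is given by $\kappa(a,k,b)=k$. Steinberg algebra. For an ample groupoid $\mathfrak{G}$ (étale with a base of compact open bisections), $A_K(\mathfrak{G})$ is the $K$-span in $K^{\mathfrak{G}}$ of the characteristic functions $1_U$ of compact open bisections $U$, with convolution $(f*g)(\gamma)=\sum_{\gamma=\alpha\beta}f(\alpha)g(\beta)$. If $\mathfrak{G}$ is $\mathbb{Z}$-graded by a continuous functor $\kappa:\mathfrak{G}\to\mathbb{Z}$, then $A_K(\mathfrak{G})$ is $\mathbb{Z}$-graded with $A_K(\mathfrak{G})_n$ the span of the $1_U$ with $U\subseteq\kappa^{-1}(n)$ a compact open bisection.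
   Formalization: The formal theorem assumes the quoted fact that all sets A(x,y,F,Q) are compact; with these definitions this holds exactly when every r(e) is finite. If some r(e) is infinite, 1_{A(r(e),r(e))} is not in the Steinberg algebra and the claim fails. *)

(* Defs.v *)
From HB Require Import structures.
From mathcomp Require Import all_boot all_order all_algebra.
From mathcomp Require Import finmap.
From mathcomp Require Import boolp classical_sets functions cardinality fsbigop.
From mathcomp Require Import topology numfun zify ring.

Set Implicit Arguments.
Unset Strict Implicit.
Unset Printing Implicit Defensive.

Import GRing.Theory.

Local Open Scope classical_set_scope.
Local Open Scope quotient_scope.
Local Open Scope ring_scope.

Definition lin_span (K : pzRingType) (M : lmodType K) (S : set M) : set M :=
  [set x | exists n (c : 'I_n -> K) (v : 'I_n -> M),
     (forall i, S (v i)) /\ x = \sum_(i < n) c i *: v i].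

Section Presentation.
Variables (K : pzRingType) (X : Type).

Inductive term :=
| Gen of X
| Zero
| Add of term & term
| Opp of term
| Scale of K & term
| Mul of term & term.

HB.instance Definition _ := gen_eqMixin term.
HB.instance Definition _ := gen_choiceMixin term.

Variable rel : term -> term -> Prop.

Inductive cong : term -> term -> Prop :=
| cong_rel t u : rel t u -> cong t u
| cong_refl t : cong t t
| cong_sym t u : cong t u -> cong u t
| cong_trans u t w : cong t u -> cong u w -> cong t w
| cong_add t t' u u' : cong t t' -> cong u u' -> cong (Add t u) (Add t' u')
| cong_opp t t' : cong t t' -> cong (Opp t) (Opp t')
| cong_scale a t t' : cong t t' -> cong (Scale a t) (Scale a t')
| cong_mul t t' u u' : cong t t' -> cong u u' -> cong (Mul t u) (Mul t' u')
| cong_addA t u w : cong (Add t (Add u w)) (Add (Add t u) w)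
| cong_addC t u : cong (Add t u) (Add u t)
| cong_add0 t : cong (Add Zero t) t
| cong_addN t : cong (Add (Opp t) t) Zero
| cong_scaleA a b t : cong (Scale a (Scale b t)) (Scale (a * b) t)
| cong_scale1 t : cong (Scale 1 t) t
| cong_scaleDr a t u : cong (Scale a (Add t u)) (Add (Scale a t) (Scale a u))
| cong_scaleDl a b t : cong (Scale (a + b) t) (Add (Scale a t) (Scale b t))
| cong_mulA t u w : cong (Mul t (Mul u w)) (Mul (Mul t u) w)
| cong_mulDl t u w : cong (Mul (Add t u) w) (Add (Mul t w) (Mul u w))
| cong_mulDr t u w : cong (Mul t (Add u w)) (Add (Mul t u) (Mul t w))
| cong_scaleAl a t u : cong (Scale a (Mul t u)) (Mul (Scale a t) u)
| cong_scaleAr a t u : cong (Scale a (Mul t u)) (Mul t (Scale a u)).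

Definition congb (t u : term) : bool := `[< cong t u >].

Lemma congb_refl : reflexive congb.
Proof. by move=> t; apply/asboolP; exact: cong_refl. Qed.

Lemma congb_sym : symmetric congb.
Proof. by move=> t u; apply/asboolP/asboolP; exact: cong_sym. Qed.

Lemma congb_trans : transitive congb.
Proof.
by move=> u t w /asboolP tu /asboolP uw; apply/asboolP; exact: cong_trans tu uw.
Qed.

Canonical cong_equiv := EquivRel congb congb_refl congb_sym congb_trans.

Definition presented := {eq_quot cong_equiv}.

HB.instance Definition _ := Choice.on presented.

Definition pclass (t : term) : presented := \pi_({eq_quot cong_equiv})%qT t.

Definition pgen (x : X) : presented := pclass (Gen x).

Lemma pclassP t u : pclass t = pclass u <-> cong t u.
Proof.
split=> [/eqP|tu]; first by rewrite eqmodE => /asboolP.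
by apply/eqP; rewrite eqmodE; apply/asboolP.
Qed.

Lemma pclass_ind (P : presented -> Prop) :
  (forall t, P (pclass t)) -> forall x, P x.
Proof. by move=> Pc x; rewrite -[x]reprK; exact: Pc. Qed.

Definition prepr (x : presented) : term := repr x.

Lemma preprP t : cong (prepr (pclass t)) t.
Proof. by apply/pclassP; rewrite /pclass reprK. Qed.

Definition padd (x y : presented) := pclass (Add (prepr x) (prepr y)).
Definition popp (x : presented) := pclass (Opp (prepr x)).
Definition pscale (a : K) (x : presented) := pclass (Scale a (prepr x)).
Definition pmul (x y : presented) := pclass (Mul (prepr x) (prepr y)).

Lemma paddE t u : padd (pclass t) (pclass u) = pclass (Add t u).
Proof. by apply/pclassP; apply: cong_add; exact: preprP. Qed.
Lemma poppE t : popp (pclass t) = pclass (Opp t).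
Proof. by apply/pclassP; apply: cong_opp; exact: preprP. Qed.
Lemma pscaleE a t : pscale a (pclass t) = pclass (Scale a t).
Proof. by apply/pclassP; apply: cong_scale; exact: preprP. Qed.
Lemma pmulE t u : pmul (pclass t) (pclass u) = pclass (Mul t u).
Proof. by apply/pclassP; apply: cong_mul; exact: preprP. Qed.

Lemma paddA : associative padd.
Proof.
elim/pclass_ind=> t; elim/pclass_ind=> u; elim/pclass_ind=> w.
by rewrite !paddE; apply/pclassP; exact: cong_addA.
Qed.

Lemma paddC : commutative padd.
Proof.
elim/pclass_ind=> t; elim/pclass_ind=> u.
by rewrite !paddE; apply/pclassP; exact: cong_addC.
Qed.

Lemma padd0 : left_id (pclass Zero) padd.
Proof. by elim/pclass_ind=> t; rewrite paddE; apply/pclassP; exact: cong_add0. Qed.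

Lemma paddN : left_inverse (pclass Zero) popp padd.
Proof.
by elim/pclass_ind=> t; rewrite poppE paddE; apply/pclassP; exact: cong_addN.
Qed.

HB.instance Definition _ :=
  GRing.isZmodule.Build presented paddA paddC padd0 paddN.

Lemma pscaleA a b x : pscale a (pscale b x) = pscale (a * b) x.
Proof.
by elim/pclass_ind: x => t; rewrite !pscaleE; apply/pclassP; exact: cong_scaleA.
Qed.

Lemma pscale1 : left_id 1 pscale.
Proof.
by elim/pclass_ind=> t; rewrite pscaleE; apply/pclassP; exact: cong_scale1.
Qed.

Lemma pscaleDr : right_distributive pscale +%R.
Proof.
move=> a; elim/pclass_ind=> t; elim/pclass_ind=> u; rewrite /GRing.add /=.
by rewrite !(paddE, pscaleE); apply/pclassP; exact: cong_scaleDr.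
Qed.

Lemma pscaleDl x : {morph pscale^~ x : a b / a + b}.
Proof.
move=> a b; elim/pclass_ind: x => t; rewrite {2}/GRing.add /=.
by rewrite !(paddE, pscaleE); apply/pclassP; exact: cong_scaleDl.
Qed.

HB.instance Definition _ := GRing.Zmodule_isLmodule.Build K presented
  pscaleA pscale1 pscaleDr pscaleDl.

Lemma pmulA : associative pmul.
Proof.
elim/pclass_ind=> t; elim/pclass_ind=> u; elim/pclass_ind=> w.
by rewrite !pmulE; apply/pclassP; exact: cong_mulA.
Qed.

Lemma pmulDl : left_distributive pmul +%R.
Proof.
elim/pclass_ind=> t; elim/pclass_ind=> u; elim/pclass_ind=> w.
by rewrite /GRing.add /= !(paddE, pmulE); apply/pclassP; exact: cong_mulDl.
Qed.

Lemma pmulDr : right_distributive pmul +%R.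
Proof.
elim/pclass_ind=> t; elim/pclass_ind=> u; elim/pclass_ind=> w.
by rewrite /GRing.add /= !(paddE, pmulE); apply/pclassP; exact: cong_mulDr.
Qed.

Lemma pscaleAl (a : K) (x y : presented) : a *: pmul x y = pmul (a *: x) y.
Proof.
elim/pclass_ind: x => t; elim/pclass_ind: y => u; rewrite /GRing.scale /=.
by rewrite !(pscaleE, pmulE); apply/pclassP; exact: cong_scaleAl.
Qed.

Lemma pscaleAr (a : K) (x y : presented) : a *: pmul x y = pmul x (a *: y).
Proof.
elim/pclass_ind: x => t; elim/pclass_ind: y => u; rewrite /GRing.scale /=.
by rewrite !(pscaleE, pmulE); apply/pclassP; exact: cong_scaleAr.
Qed.

End Presentation.

Arguments Gen {K X}.
Arguments Zero {K X}.

(* [gmul a b] is only meaningful when [gsrc a = grng b]. *)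
Record groupoid_on (T : Type) := GroupoidOn {
  grng : T -> T;
  gsrc : T -> T;
  ginv : T -> T;
  gmul : T -> T -> T;
  grng_rng : forall a, grng (grng a) = grng a;
  gsrc_rng : forall a, gsrc (grng a) = grng a;
  grng_src : forall a, grng (gsrc a) = gsrc a;
  gsrc_src : forall a, gsrc (gsrc a) = gsrc a;
  grng_inv : forall a, grng (ginv a) = gsrc a;
  gsrc_inv : forall a, gsrc (ginv a) = grng a;
  grng_mul : forall a b, gsrc a = grng b -> grng (gmul a b) = grng a;
  gsrc_mul : forall a b, gsrc a = grng b -> gsrc (gmul a b) = gsrc b;
  gmulA : forall a b c, gsrc a = grng b -> gsrc b = grng c ->
    gmul a (gmul b c) = gmul (gmul a b) c;
  gmul1 : forall a, gmul a (gsrc a) = a;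
  gmul1l : forall a, gmul (grng a) a = a;
  gmulV : forall a, gmul a (ginv a) = grng a;
  gmulVl : forall a, gmul (ginv a) a = gsrc a
}.

Section Steinberg.
Variables (K : fieldType) (T : topologicalType) (G : groupoid_on T).

(* For an open set of an etale groupoid, injectivity makes both maps
   homeomorphisms onto open sets of units. *)
Definition bisection (U : set T) : Prop :=
  {in U &, injective (grng G)} /\ {in U &, injective (gsrc G)}.

Definition compact_open_bisection (U : set T) : Prop :=
  [/\ compact U, open U & bisection U].

(* K^o is K as a K-module. *)
Definition steinberg : set (T -> K^o) :=
  @lin_span K (T -> K^o) [set (\1_U : T -> K^o) | U in compact_open_bisection].

(* The sum is over all factorisations; it has finite support for [f], [g] in
   the Steinberg algebra of an ample groupoid. *)
Definition convolution (f g : T -> K^o) : T -> K^o := fun c =>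
  \sum_(p \in [set p : T * T | gsrc G p.1 = grng G p.2 /\ gmul G p.1 p.2 = c])
    f p.1 * g p.2.

Definition steinberg_comp (kappa : T -> int) (n : int) : set (T -> K^o) :=
  @lin_span K (T -> K^o) [set (\1_U : T -> K^o) | U in
    [set U | compact_open_bisection U /\ U `<=` [set g | kappa g = n]]].

End Steinberg.

Arguments steinberg K {T} G.
Arguments steinberg_comp K {T} G kappa n.

Record ultragraph := Ultragraph {
  vertex : countType;
  edge : countType;
  esrc : edge -> vertex;
  erng : edge -> set vertex;
  erng_neq0 : forall e, erng e !=set0
}.

Section Ultragraph.
Variable G : ultragraph.
Local Notation V := (vertex G).
Local Notation E := (edge G).

Definition emitted (A : set V) : set E := [set e | A (esrc e)].
Definition sink (v : V) : Prop := emitted [set v] = set0.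
Definition regular (v : V) : Prop :=
  emitted [set v] !=set0 /\ finite_set (emitted [set v]).

(* "Finite unions" includes the empty one, so that the empty set is a member;
   "finite intersections" are those of nonempty families. *)
Inductive inG0 : set (set V) :=
| inG0_0 : inG0 set0
| inG0_1 v : inG0 [set v]
| inG0_rng e : inG0 (erng e)
| inG0_U A B : inG0 A -> inG0 B -> inG0 (A `|` B)
| inG0_I A B : inG0 A -> inG0 B -> inG0 (A `&` B).

Record vset := VSet { vset_set :> set V; vsetP : inG0 vset_set }.

Definition vset0 := VSet inG0_0.
Definition vset1 v := VSet (inG0_1 v).
Definition vrng e := VSet (inG0_rng e).
Definition vsetU (A B : vset) := VSet (inG0_U (vsetP A) (vsetP B)).
Definition vsetI (A B : vset) := VSet (inG0_I (vsetP A) (vsetP B)).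

Lemma vset_inj (A B : vset) : vset_set A = vset_set B -> A = B.
Proof.
by case: A B => [A PA] [B PB] /= AB; subst B; rewrite (Prop_irrelevance PA PB).
Qed.

Definition consec (e f : E) : bool := `[< erng e (esrc f) >].

Inductive fpath :=
| FVset of vset
| FEdges e l of path consec e l.

Definition flen (p : fpath) : nat :=
  match p with FVset _ => 0 | FEdges _ l _ => (size l).+1 end.

Record ipath := IPath {
  iedge :> nat -> E;
  ipathP : forall i, erng (iedge i) (esrc (iedge i.+1))
}.

Inductive lpa_gen := LP of vset | LS of E | LSs of E.

Section LPA.
Variable K : fieldType.

Local Notation p A := (@Gen K _ (LP A)).
Local Notation s e := (@Gen K _ (LS e)).
Local Notation s' e := (@Gen K _ (LSs e)).

Inductive lpa_rel : term K lpa_gen -> term K lpa_gen -> Prop :=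
| lpa_p0 : lpa_rel (p vset0) Zero
| lpa_pI A B : lpa_rel (Mul (p A) (p B)) (p (vsetI A B))
| lpa_pU A B :
    lpa_rel (p (vsetU A B)) (Add (Add (p A) (p B)) (Opp (p (vsetI A B))))
| lpa_ps e : lpa_rel (Mul (p (vset1 (esrc e))) (s e)) (s e)
| lpa_sp e : lpa_rel (Mul (s e) (p (vrng e))) (s e)
| lpa_ps' e : lpa_rel (Mul (p (vrng e)) (s' e)) (s' e)
| lpa_s'p e : lpa_rel (Mul (s' e) (p (vset1 (esrc e)))) (s' e)
| lpa_s's e f :
    lpa_rel (Mul (s' e) (s f)) (if e == f then p (vrng e) else Zero)
| lpa_ck v : regular v ->
    lpa_rel (p (vset1 v))
      (foldr (@Add K lpa_gen) Zero
        [seq Mul (s e) (s' e) | e <- fset_set (emitted [set v])]).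

Definition lpa := presented lpa_rel.

Definition lpa_p (A : vset) : lpa := pgen lpa_rel (LP A).
Definition lpa_s (e : E) : lpa := pgen lpa_rel (LS e).
Definition lpa_s' (e : E) : lpa := pgen lpa_rel (LSs e).

Definition lpa_mul (a b : lpa) : lpa := pmul a b.

Definition lpa_path (a : fpath) : lpa :=
  match a with
  | FVset A => lpa_p A
  | FEdges e l _ => foldl (fun x f => lpa_mul x (lpa_s f)) (lpa_s e) l
  end.

Definition lpa_path' (a : fpath) : lpa :=
  match a with
  | FVset A => lpa_p A
  | FEdges e l _ => foldl (fun x f => lpa_mul (lpa_s' f) x) (lpa_s' e) l
  end.

Definition lpa_comp (n : int) : set lpa :=
  lin_span [set x | exists (a b : fpath) (A : vset),
    (flen a)%:Z - (flen b)%:Z = n /\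
    x = lpa_mul (lpa_mul (lpa_path a) (lpa_p A)) (lpa_path' b)].

End LPA.

Definition ends_over (l : seq E) (A : set V) : Prop :=
  if l is e :: l' then A `<=` erng (last e l') else True.

(* The pair (alpha, A); when alpha is empty this encodes the ultrapath A of
   length 0. *)
Record ultrapath := UPath {
  uedges : seq E;
  urng : vset;
  uedgesP : sorted consec uedges;
  urngP : ends_over uedges urng
}.

Definition ulen (x : ultrapath) : nat := size (uedges x).

Definition uvset (A : vset) : ultrapath := @UPath [::] A isT I.
Definition uedge (e : E) : ultrapath :=
  @UPath [:: e] (vrng e) isT (@subset_refl _ (erng e)).

(* The partial product as a graph: x . y is defined and equal to z.  The two
   cases of [uedges y] cover the four product rules for finite ultrapaths. *)
Definition umul (x y z : ultrapath) : Prop :=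
  uedges z = uedges x ++ uedges y /\
  if uedges y is e :: _ then vset_set (urng x) (esrc e) /\ urng z = urng y
  else urng x `&` urng y !=set0 /\ urng z = vsetI (urng x) (urng y).

Definition imul (x : ultrapath) (c d : ipath) : Prop :=
  vset_set (urng x) (esrc (c 0%N)) /\
  forall i, d i = if (i < ulen x)%N then nth (d i) (uedges x) i
                  else c (i - ulen x)%N.

Definition G0_filter (F : set (set V)) : Prop :=
  [/\ F `<=` inG0, ~ F set0, forall A B, F A -> F B -> F (A `&` B) &
      forall A B, F A -> inG0 B -> A `<=` B -> F B].

Definition G0_ultrafilter (F : set (set V)) : Prop :=
  G0_filter F /\ forall F', G0_filter F' -> F `<=` F' -> F' = F.

Definition ultraset (A : vset) : Prop :=
  G0_ultrafilter [set B | inG0 B /\ A `<=` B].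

Definition Yinf (y : ultrapath) : Prop :=
  ultraset (urng y) /\ infinite_set (emitted (urng y)).

(* The set X_G, disjoint union of Y_infty and p^infty. *)
Inductive bpath :=
| BFin y of Yinf y
| BInf of ipath.

Definition bmul (x : ultrapath) (mu nu : bpath) : Prop :=
  match mu, nu with
  | BFin y _, BFin z _ => umul x y z
  | BInf c, BInf d => imul x c d
  | _, _ => False
  end.

Definition arrowp (a : bpath) (k : int) (b : bpath) : Prop :=
  exists x y mu, [/\ urng x = urng y, bmul x mu a, bmul y mu b &
                     k = (ulen x)%:Z - (ulen y)%:Z].

Record arrow := Arrow {
  arng : bpath;
  adeg : int;
  asrc : bpath;
  arrowP : arrowp arng adeg asrc
}.

HB.instance Definition _ := gen_eqMixin arrow.
HB.instance Definition _ := gen_choiceMixin arrow.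

Definition cyl (x y : ultrapath) : set arrow :=
  [set g | exists mu, [/\ bmul x mu (arng g), bmul y mu (asrc g) &
                          adeg g = (ulen x)%:Z - (ulen y)%:Z]].

(* The set A(x . z, y . z), empty if the products are undefined. *)
Definition cyl_mul (x y z : ultrapath) : set arrow :=
  [set g | exists x' y', [/\ umul x z x', umul y z y' & cyl x' y' g]].

Definition cylD (x y : ultrapath) (F : set E) (Q : set vset) : set arrow :=
  cyl x y `\`
   (\bigcup_(e in F) cyl_mul x y (uedge e) `|`
    \bigcup_(C in Q) cyl_mul x y (uvset C)).

(* These sets are open by definition of the topology, but they need not be
   compact: if A is infinite and G has no sinks, then A(A, A) is the disjoint union of the
   nonempty open sets A({v}, {v}), v in A.  Their compactness is therefore a
   hypothesis wherever it is needed. *)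
Definition basic : set (set arrow) :=
  [set U | exists x y F Q,
    [/\ urng x = urng y, finite_set F, F `<=` emitted (urng x),
        finite_set Q & U = cylD x y F Q]].

Definition bnth (b : bpath) (i : nat) : option E :=
  match b with BFin y _ => onth (uedges y) i | BInf c => Some (c i) end.

Definition bend (b : bpath) : option vset :=
  match b with BFin y _ => Some (urng y) | BInf _ => None end.

Definition bvert (b : bpath) (i : nat) : set V :=
  match bnth b i with
  | Some e => [set esrc e]
  | None => match bend b with Some A => A | None => set0 end
  end.

Definition starts (x : ultrapath) (a : bpath) : Prop :=
  (forall i, (i < ulen x)%N -> bnth a i = onth (uedges x) i) /\
  bvert a (ulen x) `<=` urng x.

End Ultragraph.

Section UltragraphGroupoid.
Variable G : ultragraph.
Local Notation V := (vertex G).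
Local Notation E := (edge G).

Lemma ultraset_atom (A C : vset G) :
  ultraset A -> A `&` C !=set0 -> A `<=` C.
Proof.
case=> -[_ nF0 _ _] max [v [Av Cv]].
have A0 : A !=set0 by exists v.
have F'F := max [set B | inG0 B /\ A `&` C `<=` B].
have : [set B | inG0 B /\ A `&` C `<=` B] (vsetI A C).
  by split => //; exact: vsetP.
rewrite F'F => [[_ /= h] w /h[]//||].
- split=> [B []//|[_] /(_ v)|B D [GB sB] [GD sD]|B D [GB sB] GD BD].
  + by apply.
  + by split; [exact: inG0_I|rewrite subsetI].
  + by split => //; apply: subset_trans BD.
- by move=> B [GB sB]; split => // w [/sB].
Qed.

Lemma ultraset_neq0 (A : vset G) : ultraset A -> A !=set0.
Proof.
case=> -[_ nF0 _ _] _; apply/set0P/negP => /eqP A0; apply: nF0.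
by split; [exact: inG0_0|rewrite A0].
Qed.

Lemma bpath_ext (a b : bpath G) :
  (forall i, bnth a i = bnth b i) -> bend a = bend b -> a = b.
Proof.
case: a b => [[s A sP AP] yP|[c cP]] [[t B tP BP] zP|[d dP]] //= h.
  move=> [AB]; have st := eq_from_onth h; subst.
  rewrite (Prop_irrelevance AP BP) in yP *.
  rewrite (bool_irrelevance sP tP) in yP *.
  by rewrite (Prop_irrelevance yP zP).
move=> _; have cd : c = d by apply/funext => i; have [] := h i.
by subst; rewrite (Prop_irrelevance cP dP).
Qed.

Lemma bvertS (b : bpath G) m e : bnth b m = Some e ->
  exists A : vset G, vset_set A = bvert b m.+1 /\ A `<=` erng e.
Proof.
rewrite /bvert; case: b => [[s A sP AP] yP|[c cP]]; rewrite /bnth /=; last first.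
  by move=> [<-]; exists (vset1 (esrc (c m.+1))); split=> // _ ->; exact: cP.
rewrite -/(onth s m.+1); case E1 : (onth s m.+1) => [f|] h.
  exists (vset1 (esrc f)); split => // _ ->.
  elim: s m sP {AP yP} h E1 => // x s IH [|m].
    by case: s {IH} => //= y s /andP[/asboolP xy _] [<-] [<-].
  by move=> /= /path_sorted; exact: IH.
exists A; split => //.
elim: s m sP AP {yP} h E1 => [|x s IH [|m]]; first by move=> m; rewrite onth0n.
  by case: s {IH} => //= _ + [<-].
case: s IH => [|y s] IH; first by rewrite /= onth0n.
by move=> /= /andP[_ sP] AP; exact: IH.
Qed.

Lemma bvert_vset (b : bpath G) m :
  (forall i, (i < m)%N -> bnth b i) ->
  exists A : vset G, vset_set A = bvert b m.
Proof.
case: m => [_|m /(_ m (ltnSn _))].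
  rewrite /bvert; case: b => [[[|e s] A sP AP] yP|c] /=.
  - by exists A.
  - by exists (vset1 (esrc e)).
  - by exists (vset1 (esrc (c 0%N))).
by case h: (bnth b m) => [e|//] _; have [A [? _]] := bvertS h; exists A.
Qed.

Lemma onth_drop (T : Type) (s : seq T) m i : onth (drop m s) i = onth s (m + i)%N.
Proof. by elim: s m => [|x s IH] [|m] //=; rewrite ?onth0n. Qed.

Lemma bpath_drop (b : bpath G) m : (forall i, (i < m)%N -> bnth b i) ->
  exists mu, (forall i, bnth mu i = bnth b (m + i)%N) /\ bend mu = bend b.
Proof.
case: b => [[s A sP AP] yP|[c cP]] /= h; last first.
  have dP i : erng (c (m + i)%N) (esrc (c (m + i.+1)%N)) by rewrite addnS; exact: cP.
  by exists (BInf (@IPath G (fun i => c (m + i)%N) dP)).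
have dsP : sorted (@consec G) (drop m s) by rewrite drop_sorted.
have dAP : ends_over (drop m s) A.
  case: s AP {sP yP dsP h} m => // x s AP [//|m] /=.
  elim: s x m AP => // y s IH x [//|m]; exact: IH.
pose y := UPath dsP dAP.
exists (@BFin G y yP) => /=; split=> // i.
exact: onth_drop.
Qed.

Lemma bmulP x (mu a : bpath G) : bmul x mu a <->
  [/\ starts x a, forall i, bnth mu i = bnth a (ulen x + i)%N & bend mu = bend a].
Proof.
rewrite /starts /bvert; case: mu a => [y yP|c] [z zP|d] //=.
- rewrite /umul; split=> [[-> h]|[[zx rx] xz [yz]]].
    rewrite onth_cat ltnn subnn; split.
    + split=> [i ix|]; first by rewrite onth_cat ix.
      case: (uedges y) h => [|e s] /= [].
        by move=> _ -> ? [].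
      by move=> xe _ _ ->.
    + by move=> i; rewrite onth_cat ltnNge leq_addr /= addKn.
    + congr Some; case: (uedges y) h => [|e s] /= [xy zy]//.
      apply: vset_inj; rewrite zy /=; apply/seteqP; split; last by move=> ? [].
      by rewrite subsetI; split => //; apply: ultraset_atom; [exact: yP.1|rewrite setIC].
  have zE : uedges z = uedges x ++ uedges y.
    apply: eq_from_onth => i; rewrite onth_cat; case: ltnP => ix; first exact: zx.
    by rewrite xz subnKC.
  split => //; move: rx; rewrite -{1}[ulen x]addn0 -xz.
  case: (uedges y) => [|e s] /= rx; last by rewrite yz; split => //; exact: rx.
  rewrite yz; have sz : urng z `<=` urng x by [].
  have xzE : urng x `&` urng z = urng z by rewrite setIC ((setIidPl _ _).2 sz).
  by split; [rewrite xzE; exact: ultraset_neq0 zP.1|exact: vset_inj].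
- by split=> // -[].
- by split=> // -[].
- split=> [[rx h]|[[dx rx] cd _]].
    split => //; last by move=> i; rewrite h ltnNge leq_addr /= addKn.
    split=> [i ix|]; last by rewrite h ltnn subnn => _ ->.
    rewrite h ix; case oi : (onth (uedges x) i) => [e|]; first by rewrite (onth_nth (d i) _ _ _ oi).
    by have := onthTE (uedges x) i; rewrite oi ix.
  split=> [|i].
    by have [->] := cd 0%N; rewrite addn0; exact: rx.
  case: ltnP => ix; last by have := cd (i - ulen x)%N; rewrite subnKC // => -[].
  by rewrite (onth_nth (d i) _ _ _ (esym (dx _ ix))).
Qed.

Lemma starts_nth x (a : bpath G) i : starts x a -> (i < ulen x)%N -> bnth a i.
Proof.
by move=> [h _] ix; rewrite (h _ ix) onthTE. Qed.

Lemma cylP x y (g : arrow G) : cyl x y g <->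
  [/\ starts x (arng g), starts y (asrc g),
    forall i, bnth (arng g) (ulen x + i)%N = bnth (asrc g) (ulen y + i)%N,
    bend (arng g) = bend (asrc g) & adeg g = (ulen x)%:Z - (ulen y)%:Z].
Proof.
split=> [[mu [/bmulP[xa an ae] /bmulP[yb bn be] dg]]|[xa yb ab eab dg]].
  by split=> // [i|]; [rewrite -an|rewrite -ae].
have [mu [mun mue]] := bpath_drop (fun i => @starts_nth _ _ i xa).
exists mu; split=> //; apply/bmulP; split=> //.
  by move=> i; rewrite mun ab.
by rewrite mue.
Qed.

Lemma bpath_starts (a : bpath G) m (A : vset G) :
  (forall i, (i < m)%N -> bnth a i) -> vset_set A = bvert a m ->
  exists x, [/\ ulen x = m, urng x = A & starts x a].
Proof.
move=> am AE.
pose s := pmap (bnth a) (iota 0 m).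
have sE : map Some s = map (bnth a) (iota 0 m).
  have : {in iota 0 m, forall i, bnth a i} by move=> i; rewrite mem_iota => /am.
  rewrite /s; elim: (iota 0 m) => //= i l IH h.
  have := h i (mem_head _ _); case: (bnth a i) => //= e _.
  by rewrite IH // => k kl; apply: h; rewrite inE kl orbT.
have ss : size s = m by rewrite -(size_map Some) sE size_map size_iota.
have sn i : (i < m)%N -> onth s i = bnth a i.
  by move=> im; rewrite onthE sE (nth_map 0%N) ?size_iota // nth_iota.
have sP : sorted (@consec G) s.
  case E1: s => // [e0 s'].
  apply/(sortedP e0) => i; rewrite -E1 ss => im.
  have nthE j : (j < m)%N -> bnth a j = Some (nth e0 s j).
    move=> jm; rewrite -sn //; have : (j < size s)%N by rewrite ss.
    elim: (s) j {jm} => // x r IH [|j] //=; exact: IH.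
  have [B [BE BP]] := bvertS (nthE _ (ltnW im)).
  apply/asboolP; apply: BP; rewrite BE /bvert (nthE _ im) //.
have AP : ends_over s A.
  case E1: s => [//|e0 s'] /=.
  have m0 : (0 < m)%N by rewrite -ss E1.
  have am1 : bnth a m.-1 = Some (last e0 s').
    rewrite -sn ?prednK // -ss E1 /=.
    by elim: (s') (e0) => // x r IH y /=; exact: IH.
  have [B [BE BP]] := bvertS am1.
  by rewrite AE -[m]prednK // -BE.
exists (UPath sP AP); split => //; split => [i|] /=; rewrite /ulen /= ss.
  by move=> im; rewrite sn.
by rewrite AE.
Qed.

Lemma arrowpP (a b : bpath G) k : arrowp a k b <->
  exists m n, [/\ forall i, (i < m)%N -> bnth a i,
    forall i, (i < n)%N -> bnth b i,
    forall i, bnth a (m + i)%N = bnth b (n + i)%N,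
    bend a = bend b & k = m%:Z - n%:Z].
Proof.
split=> [[x [y [mu [xy /bmulP[xa an ae] /bmulP[yb bn be] ->]]]]|].
  exists (ulen x), (ulen y); split => //.
  - by move=> i; exact: starts_nth.
  - by move=> i; exact: starts_nth.
  - by move=> i; rewrite -an.
  - by rewrite -ae.
move=> [m [n [am bn ab eab ->]]].
have [A AE] := bvert_vset am.
have AE' : vset_set A = bvert b n.
  by rewrite AE /bvert eab -[m]addn0 ab addn0.
have [x [xm xA xa]] := bpath_starts am AE.
have [y [yn yA yb]] := bpath_starts bn AE'.
have [mu [mun mue]] := bpath_drop am.
exists x, y, mu; rewrite xm yn; split => //; first by rewrite xA.
  by apply/bmulP; rewrite xm.
by apply/bmulP; rewrite yn mue; split => // i; rewrite mun ab.
Qed.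

Lemma arrow_inj (g h : arrow G) :
  arng g = arng h -> adeg g = adeg h -> asrc g = asrc h -> g = h.
Proof.
case: g h => [a k b gP] [a' k' b' hP] /= ? ? ?; subst.
by rewrite (Prop_irrelevance gP hP).
Qed.

Lemma arrowp_unit (a : bpath G) : arrowp a 0 a.
Proof. by apply/arrowpP; exists 0%N, 0%N; split. Qed.

Lemma arrowp_inv (a b : bpath G) k : arrowp a k b -> arrowp b (- k) a.
Proof.
move=> [x [y [mu [xy xa yb ->]]]]; exists y, x, mu; split => //.
by rewrite opprB.
Qed.

Lemma arrowp_comp (a b c : bpath G) k l :
  arrowp a k b -> arrowp b l c -> arrowp a (k + l) c.
Proof.
move=> /arrowpP[m [n [am bn ab eab ->]]] /arrowpP[m' [n' [bm cn bc ebc ->]]].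
apply/arrowpP; case: (leqP n m') => nm.
  exists (m + (m' - n))%N, n'; split => //.
  - move=> i im; case: (ltnP i m) => [/am//|mi].
    by rewrite -(subnKC mi) ab; apply: bm; lia.
  - by move=> i; rewrite -addnA ab addnA subnKC.
  - by rewrite eab.
  - by lia.
exists m, (n' + (n - m'))%N; split => //.
- move=> i im; case: (ltnP i n') => [/cn//|mi].
  by rewrite -(subnKC mi) -bc; apply: bn; lia.
- by move=> i; rewrite ab -addnA -bc addnA subnKC // ltnW.
- by rewrite eab.
- by lia.
Qed.

Definition aunit (a : bpath G) : arrow G := Arrow (arrowp_unit a).
Definition ainv (g : arrow G) : arrow G := Arrow (arrowp_inv (arrowP g)).

Definition acomp (g h : arrow G) (gh : asrc g = arng h) : arrow G :=
  Arrow (arrowp_comp (arrowP g)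
    (eq_ind_r (fun b => arrowp b (adeg h) (asrc h)) (arrowP h) gh)).

Definition amul (g h : arrow G) : arrow G :=
  if pselect (asrc g = arng h) is left gh then acomp gh else g.

Lemma aunit_inj : injective aunit.
Proof. by move=> a b []. Qed.

Lemma amulE (g h : arrow G) : asrc g = arng h ->
  [/\ arng (amul g h) = arng g, adeg (amul g h) = adeg g + adeg h &
      asrc (amul g h) = asrc h].
Proof. by rewrite /amul; case: pselect. Qed.

Definition agrng (g : arrow G) : arrow G := aunit (arng g).
Definition agsrc (g : arrow G) : arrow G := aunit (asrc g).

Lemma agrng_mul g h : agsrc g = agrng h -> agrng (amul g h) = agrng g.
Proof. by move=> /aunit_inj/amulE[r _ _]; rewrite /agrng r. Qed.

Lemma agsrc_mul g h : agsrc g = agrng h -> agsrc (amul g h) = agsrc h.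
Proof. by move=> /aunit_inj/amulE[_ _ s]; rewrite /agsrc s. Qed.

Lemma amulA g h k : agsrc g = agrng h -> agsrc h = agrng k ->
  amul g (amul h k) = amul (amul g h) k.
Proof.
move=> /aunit_inj gh /aunit_inj hk.
have [r1 d1 s1] := amulE gh; have [r2 d2 s2] := amulE hk.
have [r3 d3 s3] := amulE (etrans gh (esym r2)).
have [r4 d4 s4] := amulE (etrans s1 hk).
apply: arrow_inj; first by rewrite r3 r4.
- by rewrite d3 d4 d1 d2 addrA.
- by rewrite s3 s4.
Qed.

Lemma amul1 g : amul g (agsrc g) = g.
Proof.
have [r d s] := @amulE g (agsrc g) erefl.
by apply: arrow_inj; rewrite ?r ?d ?s //= addr0.
Qed.

Lemma amul1l g : amul (agrng g) g = g.
Proof.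
have [r d s] := @amulE (agrng g) g erefl.
by apply: arrow_inj; rewrite ?r ?d ?s //= add0r.
Qed.

Lemma amulV g : amul g (ainv g) = agrng g.
Proof.
have [r d s] := @amulE g (ainv g) erefl.
by apply: arrow_inj; rewrite ?r ?d ?s //= subrr.
Qed.

Lemma amulVl g : amul (ainv g) g = agsrc g.
Proof.
have [r d s] := @amulE (ainv g) g erefl.
by apply: arrow_inj; rewrite ?r ?d ?s //= addNr.
Qed.

Definition ultragraph_groupoid : groupoid_on (arrow G) :=
  @GroupoidOn (arrow G) agrng agsrc ainv amul
    (fun=> erefl) (fun=> erefl) (fun=> erefl) (fun=> erefl) (fun=> erefl)
    (fun=> erefl) agrng_mul agsrc_mul amulA amul1 amul1l amulV amulVl.

Definition uprefix (x x' : ultrapath G) (d : seq E) : Prop :=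
  uedges x' = uedges x ++ d /\ if d is e :: _ then vset_set (urng x) (esrc e) else urng x' `<=` urng x.

Lemma starts_prefix x x' d a : uprefix x x' d -> starts x' a -> starts x a.
Proof.
move=> [x'E dx] [ax' vx'].
have xx' : ulen x' = (ulen x + size d)%N by rewrite /ulen x'E size_cat.
split=> [i ix|].
  by rewrite ax' ?xx' ?ltn_addr // x'E onth_cat ix.
case: d x'E dx xx' => [|e d] x'E dx xx'.
  by apply: subset_trans dx; move: vx'; rewrite xx' addn0.
rewrite /bvert ax' ?xx' ?addnS ?ltnS ?leq_addr // x'E onth_cat ltnn subnn /=.
by move=> _ ->.
Qed.

Lemma cyl_prefix x y x' y' d : uprefix x x' d -> uprefix y y' d ->
  cyl x' y' `<=` cyl x y.
Proof.
move=> xd yd g /cylP[xa yb ab eab dg]; apply/cylP.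
have xx' : ulen x' = (ulen x + size d)%N by rewrite /ulen xd.1 size_cat.
have yy' : ulen y' = (ulen y + size d)%N by rewrite /ulen yd.1 size_cat.
split => //; [exact: starts_prefix xd xa|exact: starts_prefix yd yb| |].
- move=> i; case: (ltnP i (size d)) => id; last first.
    by rewrite -(subnKC id) !addnA -xx' -yy' ab.
  rewrite xa.1 ?yb.1 ?xx' ?yy' ?ltn_add2l // xd.1 yd.1 !onth_cat.
  by rewrite !ltnNge !leq_addr /= !addKn.
- by rewrite dg xx' yy' !PoszD; ring.
Qed.

Lemma umul_edge x (e : E) z : umul x (uedge e) z <->
  [/\ vset_set (urng x) (esrc e), uedges z = rcons (uedges x) e & urng z = vrng e].
Proof. by rewrite /umul /= cats1; split=> [[-> []]|[]]. Qed.

Lemma umul_edge_ex x (e : E) : vset_set (urng x) (esrc e) ->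
  exists z, umul x (uedge e) z.
Proof.
move=> xe.
have sP : sorted (@consec G) (rcons (uedges x) e).
  case: x xe => [[|f l] A sP AP] //= Ae; rewrite rcons_path.
  by rewrite -[path _ _ _]/(sorted _ (f :: l)) sP; apply/asboolP; exact: AP.
have eP : ends_over (rcons (uedges x) e) (vrng e).
  by case: (uedges x) => [|f l] //=; rewrite last_rcons.
by exists (UPath sP eP); apply/umul_edge.
Qed.

Lemma umul_vset (x : ultrapath G) (A : vset G) z : umul x (uvset A) z <->
  [/\ urng x `&` A !=set0, uedges z = uedges x & urng z = vsetI (urng x) A].
Proof. by rewrite /umul /= cats0; split=> [[-> []]|[]]. Qed.

Lemma umul_vset_ex (x : ultrapath G) (A : vset G) : urng x `&` A !=set0 -> exists z, umul x (uvset A) z.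
Proof.
move=> xA; have eP : ends_over (uedges x) (vsetI (urng x) A).
  by case: x {xA} => [[|f l] B sP BP] //= v [/BP].
by exists (UPath (uedgesP x) eP); apply/umul_vset.
Qed.

Lemma upath_ext (x y : ultrapath G) : uedges x = uedges y -> urng x = urng y -> x = y.
Proof.
case: x y => [s A sP AP] [t B tP BP] /= ? ?; subst.
by rewrite (Prop_irrelevance AP BP) (bool_irrelevance sP tP).
Qed.

Lemma ultrapath_cyl_edge x y d e x' y' z1 z2 (g : arrow G) :
  uprefix x x' (e :: d) -> uprefix y y' (e :: d) ->
  umul x (uedge e) z1 -> umul y (uedge e) z2 -> cyl x' y' g -> cyl z1 z2 g.
Proof.
have aux w w' z : uprefix w w' (e :: d) -> umul w (uedge e) z -> uprefix z w' d.
  move=> [w'E _] /umul_edge[_ zE zA]; split; first by rewrite zE w'E cat_rcons.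
  rewrite zA; case: d w'E => [|f l] w'E.
    have := urngP w'; rewrite w'E.
    by case: (uedges w) => //= f l; rewrite last_cat.
  have := uedgesP w'; rewrite w'E => /cat_sorted2[_] /= /andP[/asboolP //].
by move=> xx' yy' xz yz; exact: (cyl_prefix (aux _ _ _ xx' xz) (aux _ _ _ yy' yz)).
Qed.

Lemma bvert_neq0 (b : bpath G) i : bvert b i !=set0.
Proof.
rewrite /bvert; case bi : (bnth b i) => [e|]; first by exists (esrc e).
by case: b bi => //= y yP _; exact: ultraset_neq0 yP.1.
Qed.

Lemma cyl_edge_nth x y (e : E) (g : arrow G) : cyl_mul x y (uedge e) g ->
  bnth (arng g) (ulen x) = Some e.
Proof.
move=> [x' [y' [/umul_edge[_ x'E _] _ /cylP[[h _] _ _ _ _]]]].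
by rewrite h /ulen x'E ?size_rcons // -cats1 onth_cat ltnn subnn.
Qed.

Lemma starts_edge (x : ultrapath G) (e : E) (a : bpath G) :
  starts x a -> bnth a (ulen x) = Some e -> vset_set (urng x) (esrc e).
Proof. by move=> [_]; rewrite /bvert => + ae; rewrite ae; apply. Qed.

Lemma cyl_mul_edge_prefix x y x' y' e d (g g0 : arrow G) f :
  uprefix x x' (e :: d) -> uprefix y y' (e :: d) ->
  cyl x' y' g -> cyl x' y' g0 ->
  cyl_mul x y (uedge f) g -> cyl_mul x y (uedge f) g0.
Proof.
move=> xx' yy' g1 g01 gf; have gx := cyl_edge_nth gf.
have /cylP[[h _] _ _ _ _] := g1.
have fe : f = e.
  apply: Some_inj; rewrite -gx h /ulen xx'.1 ?size_cat ?addnS ?ltnS ?leq_addr //.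
  by rewrite onth_cat ltnn subnn.
subst f; move: gf => [z1 [z2 [xz yz _]]].
exists z1, z2; split => //; exact: (ultrapath_cyl_edge xx' yy' xz yz g01).
Qed.

Lemma cyl_mul_vset_prefix x y x' y' e d (g g0 : arrow G) C :
  uprefix x x' (e :: d) -> uprefix y y' (e :: d) ->
  cyl x' y' g -> cyl x' y' g0 ->
  cyl_mul x y (uvset C) g -> cyl_mul x y (uvset C) g0.
Proof.
move=> xx' yy' g1 g01 [z1 [z2 [xz yz gz]]].
exists z1, z2; split => //; move: xz yz.
move=> /umul_vset[_ z1E z1A] /umul_vset[_ z2E z2A].
have /cylP[gx' gy' _ _ _] := g1; have /cylP[gx gy _ _ _] := gz.
have ex : vset_set (urng z1) (esrc e).
  apply: starts_edge gx _; rewrite /ulen z1E gx'.1 /ulen xx'.1.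
    by rewrite onth_cat ltnn subnn.
  by rewrite size_cat addnS ltnS leq_addr.
have ey : vset_set (urng z2) (esrc e).
  apply: starts_edge gy _; rewrite /ulen z2E gy'.1 /ulen yy'.1.
    by rewrite onth_cat ltnn subnn.
  by rewrite size_cat addnS ltnS leq_addr.
have p1 : uprefix z1 x' (e :: d) by split => //; rewrite z1E xx'.1.
have p2 : uprefix z2 y' (e :: d) by split => //; rewrite z2E yy'.1.
exact: (cyl_prefix p1 p2).
Qed.

Lemma cylD_prefix x y x' y' e d F Q (g0 : arrow G) :
  uprefix x x' (e :: d) -> uprefix y y' (e :: d) -> cylD x y F Q g0 ->
  cyl x' y' g0 -> cyl x' y' `<=` cylD x y F Q.
Proof.
move=> xx' yy' [g0x g0n] g0x' g gx'; split; first exact: (cyl_prefix xx' yy').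
move=> [[f Ff gf]|[C QC gC]]; apply: g0n.
  by left; exists f => //; exact: (cyl_mul_edge_prefix xx' yy' gx' g0x').
by right; exists C => //; exact: (cyl_mul_vset_prefix xx' yy' gx' g0x').
Qed.

Lemma cylI x y x1 y1 x2 y2 (g : arrow G) :
  uedges x1 = uedges x -> uedges y1 = uedges y ->
  uedges x2 = uedges x -> uedges y2 = uedges y ->
  urng x1 `&` urng x2 `<=` urng x -> urng y1 `&` urng y2 `<=` urng y ->
  cyl x1 y1 g -> cyl x2 y2 g -> cyl x y g.
Proof.
rewrite /cyl => x1x y1y x2x y2y xA yA /cylP[gx1 gy1 ab eab dg] /cylP[gx2 gy2 _ _ _].
have sx : starts x (arng g).
  split; first by move: gx1.1; rewrite /ulen x1x.
  apply: subset_trans xA; rewrite subsetI; split.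
    by move: gx1.2; rewrite /ulen x1x.
  by move: gx2.2; rewrite /ulen x2x.
have sy : starts y (asrc g).
  split; first by move: gy1.1; rewrite /ulen y1y.
  apply: subset_trans yA; rewrite subsetI; split.
    by move: gy1.2; rewrite /ulen y1y.
  by move: gy2.2; rewrite /ulen y2y.
by apply/cylP; move: ab dg; rewrite /ulen x1x y1y; split.
Qed.

Lemma cyl_mul_edge_same x y z w (e : E) (g : arrow G) :
  uprefix x z [::] -> uprefix y w [::] -> cyl z w g ->
  cyl_mul x y (uedge e) g <-> cyl_mul z w (uedge e) g.
Proof.
rewrite /uprefix !cats0 => -[zE zA] [wE wA] /cylP[gz gw ab _ _].
have zx : ulen z = ulen x by rewrite /ulen zE.
split=> ge; have [x1 [y1 [xx1 yy1 g1]]] := ge.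
  have ze : vset_set (urng z) (esrc e).
    by apply: starts_edge gz _; rewrite zx; exact: cyl_edge_nth ge.
  have we : vset_set (urng w) (esrc e).
    apply: starts_edge gw _; rewrite -[ulen w]addn0 -ab addn0 zx.
    exact: cyl_edge_nth ge.
  exists x1, y1; split => //; apply/umul_edge; split => //.
  - by rewrite zE; case/umul_edge: xx1.
  - by case/umul_edge: xx1.
  - by rewrite wE; case/umul_edge: yy1.
  - by case/umul_edge: yy1.
exists x1, y1; split => //.
  by case/umul_edge: xx1 => ? ? ?; apply/umul_edge; rewrite -zE; split => //; exact: zA.
by case/umul_edge: yy1 => ? ? ?; apply/umul_edge; rewrite -wE; split => //; exact: wA.
Qed.

Lemma cyl_mul_vset_same x y z w C (g : arrow G) :
  uprefix x z [::] -> uprefix y w [::] -> cyl z w g ->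
  cyl_mul x y (uvset C) g <-> cyl_mul z w (uvset C) g.
Proof.
rewrite /uprefix !cats0 => -[zE zA] [wE wA] gzw.
have /cylP[gz gw _ _ _] := gzw.
split=> -[x1 [y1 [xx1 yy1 g1]]].
  have /umul_vset[_ x1E x1A] := xx1; have /umul_vset[_ y1E y1A] := yy1.
  have /cylP[gx gy _ _ _] := g1.
  have [v vz] := bvert_neq0 (arng g) (ulen z).
  have [u uw] := bvert_neq0 (asrc g) (ulen w).
  have [|x2 xx2] := @umul_vset_ex z C.
    exists v; split; first exact: gz.2.
    have : vset_set (urng x1) v by apply: gx.2; rewrite /ulen x1E -zE.
    by rewrite x1A => -[].
  have [|y2 yy2] := @umul_vset_ex w C.
    exists u; split; first exact: gw.2.
    have : vset_set (urng y1) u by apply: gy.2; rewrite /ulen y1E -wE.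
    by rewrite y1A => -[].
  exists x2, y2; split => //.
  move: xx2 yy2 => /umul_vset[_ x2E x2A] /umul_vset[_ y2E y2A].
  apply: cylI gzw g1; rewrite ?x2E ?y2E ?x1E ?y1E //.
    by rewrite x1A x2A /= => ? [? []].
  by rewrite y1A y2A /= => ? [? []].
have /umul_vset[[v [zv Cv]] x1E x1A] := xx1.
have /umul_vset[[u [wu Cu]] y1E y1A] := yy1.
have [|x2 xx2] := @umul_vset_ex x C; first by exists v; split => //; exact: zA.
have [|y2 yy2] := @umul_vset_ex y C; first by exists u; split => //; exact: wA.
exists x2, y2; split => //.
move: xx2 yy2 => /umul_vset[_ x2E x2A] /umul_vset[_ y2E y2A].
have p1 : uprefix x2 x1 [::].
  by split; [rewrite cats0 x1E x2E|rewrite x1A x2A; exact: setSI].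
have p2 : uprefix y2 y1 [::].
  by split; [rewrite cats0 y1E y2E|rewrite y1A y2A; exact: setSI].
exact: (cyl_prefix p1 p2).
Qed.

Lemma cylD_same x y z w F Q F' Q' (g : arrow G) :
  uprefix x z [::] -> uprefix y w [::] ->
  (F `&` emitted (urng z)) `<=` F' -> Q `<=` Q' -> cylD z w F' Q' g ->
  cylD x y F Q g.
Proof.
move=> xz yw FF' QQ' [gzw gn]; split; first exact: (cyl_prefix xz yw).
move=> [[f Ff gf]|[C QC gC]]; apply: gn.
  have gf' := (cyl_mul_edge_same f xz yw gzw).1 gf.
  left; exists f => //; apply: FF'; split => //.
  by case: gf' => ? [? [/umul_edge[]]].
by right; exists C; [exact: QQ'|exact: (cyl_mul_vset_same C xz yw gzw).1].
Qed.

Lemma cyl_len x y x' y' d (g : arrow G) : urng x = urng y ->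
  cyl x y g -> cyl x' y' g -> ulen x' = (ulen x + d)%N ->
  exists2 s, size s = d & [/\ uedges x' = uedges x ++ s,
    uedges y' = uedges y ++ s &
    forall e s', s = e :: s' ->
      vset_set (urng x) (esrc e) /\ vset_set (urng y) (esrc e)].
Proof.
move=> xy /cylP[gx gy ab _ dg] /cylP[gx' gy' _ _ dg'] x'd.
have y'd : ulen y' = (ulen y + d)%N by lia.
pose s := drop (ulen x) (uedges x').
have ss : size s = d by rewrite size_drop -/(ulen x') x'd addKn.
have sn i : (i < d)%N -> onth s i = bnth (arng g) (ulen x + i).
  by move=> id; rewrite /s onth_drop gx'.1 // x'd ltn_add2l.
have x's : uedges x' = uedges x ++ s.
  apply: eq_from_onth_le => i; rewrite size_cat ss -!/(ulen _) -x'd maxnn => ix.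
  rewrite onth_cat; case: ltnP => ixx; first by rewrite -gx'.1 // gx.1.
  by rewrite /s onth_drop subnKC.
exists s => //; split => //.
- apply: eq_from_onth_le => i; rewrite size_cat ss -!/(ulen _) -y'd maxnn => iy.
  rewrite onth_cat; case: ltnP => iyy; first by rewrite -gy'.1 // gy.1.
  rewrite sn ?ab ?subnKC ?gy'.1 //.
  by rewrite ltn_subLR // -y'd.
- move=> e s' sE; rewrite -xy; suff : vset_set (urng x) (esrc e) by [].
  apply: starts_edge gx _; rewrite -[ulen x]addn0 -sn ?sE //.
  by rewrite -ss sE.
Qed.

Lemma basic_join (U W : set (arrow G)) g : basic U -> basic W -> U g -> W g ->
  exists Z, [/\ basic Z, Z g & Z `<=` U `&` W].
Proof.
move=> [x [y [F [Q [xy fF Fx fQ ->]]]]] [x' [y' [F' [Q' [xy' fF' Fx' fQ' ->]]]]].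
move=> gU gW; wlog xx' : x y F Q xy fF Fx fQ gU x' y' F' Q' xy' fF' Fx' fQ' gW /
    (ulen x <= ulen x')%N.
  move=> H; case: (leqP (ulen x) (ulen x')) => [|/ltnW] h.
    exact: (H _ _ _ _ xy fF Fx fQ gU _ _ _ _ xy' fF' Fx' fQ' gW h).
  have [Z [bZ gZ ZUW]] := H _ _ _ _ xy' fF' Fx' fQ' gW _ _ _ _ xy fF Fx fQ gU h.
  by exists Z; split => //; rewrite setIC.
have [s ss [x'E y'E es]] := cyl_len xy gU.1 gW.1 (esym (subnKC xx')).
case: s ss x'E y'E es => [|e s] ss x'E y'E es.
- rewrite !cats0 in x'E y'E.
  have /cylP[gx gy _ _ _] := gU.1; have /cylP[gx' gy' _ _ _] := gW.1.
  have [v vx] := bvert_neq0 (arng g) (ulen x).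
  have xv : (urng x `&` urng x') v.
    by split; [exact: gx.2|apply: gx'.2; rewrite /ulen x'E].
  have [|z xz] := @umul_vset_ex x (urng x'); first by exists v.
  have [|w yw] := @umul_vset_ex y (urng y'); first by rewrite -xy -xy'; exists v.
  have /umul_vset[_ zE zA] := xz; have /umul_vset[_ wE wA] := yw.
  have xz0 : uprefix x z [::].
    by split; [rewrite cats0|rewrite zA => ? []].
  have xz0' : uprefix x' z [::].
    by split; [rewrite cats0 x'E|rewrite zA => ? []].
  have yw0 : uprefix y w [::].
    by split; [rewrite cats0|rewrite wA => ? []].
  have yw0' : uprefix y' w [::].
    by split; [rewrite cats0 y'E|rewrite wA => ? []].
  have gzw : cyl z w g.
    by apply: cylI gU.1 gW.1; rewrite ?zE ?wE ?zA ?wA // ?x'E ?y'E.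
  exists (cylD z w ((F `|` F') `&` emitted (urng z)) (Q `|` Q')); split.
  - exists z, w, ((F `|` F') `&` emitted (urng z)), (Q `|` Q'); split => //.
    - by rewrite zA wA xy xy'.
    - by apply: finite_setIl; rewrite finite_setU.
    - by rewrite finite_setU.
  - split => //; case: gU gW => [gxy nU] [gxy' nW].
    move=> [[f [[Ff|Ff] fz] gf]|[C [QC|QC] gC]].
    + by apply: nU; left; exists f => //; apply/(cyl_mul_edge_same _ xz0 yw0 gzw).
    + by apply: nW; left; exists f => //; apply/(cyl_mul_edge_same _ xz0' yw0' gzw).
    + by apply: nU; right; exists C => //; apply/(cyl_mul_vset_same _ xz0 yw0 gzw).
    + by apply: nW; right; exists C => //; apply/(cyl_mul_vset_same _ xz0' yw0' gzw).
  - move=> h hzw; split.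
      apply: cylD_same xz0 yw0 _ _ hzw => //.
      by move=> f [Ff fz]; split => //; left.
    apply: cylD_same xz0' yw0' _ _ hzw => //.
    by move=> f [Ff fz]; split => //; right.
- have [ex ey] := es _ _ erefl.
  exists (cylD x' y' F' Q'); split => //; first by exists x', y', F', Q'.
  move=> h hW; split => //.
  by apply: (cylD_prefix _ _ gU gW.1 hW.1); split; [exact: x'E| |exact: y'E|].
Qed.

Lemma basic_cover : \bigcup_(U in @basic G) U = setT.
Proof.
apply/seteqP; split=> // g _.
have [x [y [mu [xy xa yb kE]]]] := arrowP g.
exists (cylD x y set0 set0).
  by exists x, y, set0, set0; split => //; exact: sub0set.
split; first by exists mu.
by move=> [] [].
Qed.

End UltragraphGroupoid.

HB.instance Definition _ (G : ultragraph) := @isBaseTopological.Build (arrow G)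
  (set (arrow G)) (@basic G) id (@basic_cover G) (@basic_join G).

(* Main.v *)
(* L_K(G) acts on the functions on X_G x Z (X_G the boundary path space, the
   integer recording the degree): s_e and s_e^* add and remove a first edge.
   The matrix coefficients of this action are functions on the groupoid, and
   products go to convolutions.  Compactness of the basic sets forces every A in
   G^0 to be finite, so L_K(G) is spanned by the s_al p_v s_be^*.  Expanding
   regular v by the Cuntz-Krieger relation, an element is a combination of such
   monomials with either |al| = N, or |al| < N and v an infinite emitter; these
   are told apart by their values at suitable arrows, hence injectivity.
   Surjectivity holds because the span of the indicators of the cylinders A(x, y)
   is closed under pointwise products and so contains the indicator of every
   compact open set. *)
Require Import Defs.
From HB Require Import structures.
From mathcomp Require Import all_boot all_order all_algebra.
From mathcomp Require Import boolp classical_sets functions topology numfun.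
From mathcomp Require Import cardinality fsbigop finmap zify ring.

Set Implicit Arguments.
Unset Strict Implicit.
Unset Printing Implicit Defensive.

Import GRing.Theory.

Local Open Scope classical_set_scope.
Local Open Scope ring_scope.

(** * Linear spans *)

Section LinSpan.
Variables (K : pzRingType) (M : lmodType K).
Implicit Types (S : set M) (x y v : M).

(** With combinations indexed by sequences of pairs, closure under addition becomes
    concatenation. *)
Lemma lin_spanP S x : lin_span S x <->
  exists2 s : seq (K * M), (forall p, p \in s -> S p.2) &
    x = \sum_(p <- s) p.1 *: p.2.
Proof.
split=> [[n [c [v [Sv ->]]]]|[s Ss ->]].
  exists [seq (c i, v i) | i <- enum 'I_n].
    by move=> p /mapP[i _ ->]; exact: Sv.
  by rewrite big_map big_enum.
exists (size s), (fun i => (tnth (in_tuple s) i).1), (fun i => (tnth (in_tuple s) i).2).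
by split=> [i|]; [exact/Ss/mem_tnth|rewrite [LHS]big_tnth].
Qed.

Lemma lin_span0 S : lin_span S 0.
Proof. by apply/lin_spanP; exists [::]; rewrite ?big_nil. Qed.

Lemma lin_spanD S x y : lin_span S x -> lin_span S y -> lin_span S (x + y).
Proof.
move=> /lin_spanP[s Ss ->] /lin_spanP[t St ->]; apply/lin_spanP.
exists (s ++ t); last by rewrite big_cat.
by move=> p; rewrite mem_cat => /orP[/Ss|/St].
Qed.

Lemma lin_spanZ S c x : lin_span S x -> lin_span S (c *: x).
Proof.
move=> /lin_spanP[s Ss ->]; apply/lin_spanP.
exists [seq (c * p.1, p.2) | p <- s]; first by move=> p /mapP[q /Ss Sq ->].
by rewrite big_map scaler_sumr; apply: eq_bigr => p _; rewrite scalerA.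
Qed.

Lemma lin_span_gen S x : S x -> lin_span S x.
Proof.
move=> Sx; apply/lin_spanP; exists [:: (1, x)]; last by rewrite big_seq1 scale1r.
by move=> p; rewrite inE => /eqP ->.
Qed.

Lemma lin_span_sum S (I : Type) (r : seq I) (P : pred I) (F : I -> M) :
  (forall i, P i -> lin_span S (F i)) -> lin_span S (\sum_(i <- r | P i) F i).
Proof.
by move=> SF; apply: big_ind => //; [exact: lin_span0|move=> x y; exact: lin_spanD].
Qed.

Lemma lin_spanB S x y : lin_span S x -> lin_span S y -> lin_span S (x - y).
Proof. by move=> Sx Sy; rewrite -scaleN1r; apply/lin_spanD/lin_spanZ. Qed.

Lemma lin_span_ind S (P : M -> Prop) : P 0 -> (forall x y, P x -> P y -> P (x + y)) ->
  (forall c x, P x -> P (c *: x)) -> S `<=` P -> lin_span S `<=` P.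
Proof.
move=> P0 PD PZ SP _ [n [c [v [Sv ->]]]].
by apply: big_ind => // i _; apply/PZ/SP.
Qed.

Lemma lin_span_sub S S' : S `<=` lin_span S' -> lin_span S `<=` lin_span S'.
Proof.
move=> SS'; apply: lin_span_ind => //; first exact: lin_span0.
  by move=> x y; exact: lin_spanD.
by move=> c x; exact: lin_spanZ.
Qed.

End LinSpan.

Lemma lin_span_linear (K : pzRingType) (M N : lmodType K) (f : {linear M -> N})
  (S : set M) : f @` lin_span S = lin_span (f @` S).
Proof.
apply/seteqP; split=> [_ [x Sx <-]|].
  move: x Sx; apply: lin_span_ind => [|x y|c x|x Sx].
  - by rewrite linear0; exact: lin_span0.
  - by rewrite linearD; exact: lin_spanD.
  - by rewrite linearZ; exact: lin_spanZ.
  - by apply: lin_span_gen; exists x.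
apply: lin_span_ind => [|_ _ [x Sx <-] [y Sy <-]|c _ [x Sx <-]|_ [x Sx <-]].
- by exists 0; [exact: lin_span0|rewrite linear0].
- by exists (x + y); [exact: lin_spanD|rewrite linearD].
- by exists (c *: x); [exact: lin_spanZ|rewrite linearZ].
- by exists x => //; exact: lin_span_gen.
Qed.

(** * Source, tail and prefixing for boundary paths *)

Section BoundaryPaths.
Variable G : ultragraph.
Local Notation V := (vertex G).
Local Notation E := (edge G).
Implicit Types (a b : bpath G) (e f : E).

Definition bsrc a : V := projT1 (cid (bvert_neq0 a 0)).

(** Only length 0 has content: an ultraset that meets a member of G^0 is contained in it, and
    singletons are members of G^0. *)
Lemma bvert0 a : bvert a 0 = [set bsrc a].
Proof.
rewrite /bsrc; case: cid => v /=; rewrite /bvert.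
case: a => [[[|f l] A sP AP] yP|c] /=; try by move=> ->.
move=> Av; apply/seteqP; split=> [|_ -> //].
by apply: (@ultraset_atom G A (vset1 v) yP.1); exists v.
Qed.

Lemma bsrc_hd a e : bnth a 0 = Some e -> bsrc a = esrc e.
Proof.
by move=> ae; have : [set bsrc a] (bsrc a) by []; rewrite -bvert0 /bvert ae.
Qed.

(** The guard inside the existential lets choice produce a total function; without a first edge its
    value is arbitrary. [bcons_subproof] has the same form. *)
Lemma btl_subproof a : exists b, bnth a 0 ->
  (forall i, bnth b i = bnth a i.+1) /\ bend b = bend a.
Proof.
case a0 : (isSome (bnth a 0)); last by exists a.
by have [|b bP] := @bpath_drop G a 1; [case|exists b].
Qed.

Definition btl a := projT1 (cid (btl_subproof a)).

Lemma btlP a e : bnth a 0 = Some e ->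
  (forall i, bnth (btl a) i = bnth a i.+1) /\ bend (btl a) = bend a.
Proof. by rewrite /btl => a0; case: cid => b /=; rewrite a0; exact. Qed.

Lemma bvert_tl a e i : bnth a 0 = Some e -> bvert (btl a) i = bvert a i.+1.
Proof. by move=> /btlP[bn be]; rewrite /bvert bn be. Qed.

Lemma bsrc_tl a e : bnth a 0 = Some e -> erng e (bsrc (btl a)).
Proof.
move=> a0; have [A [AE Ae]] := bvertS a0; apply: Ae.
by rewrite AE -(bvert_tl 0 a0) bvert0.
Qed.

Lemma bcons_subproof e b : exists a, erng e (bsrc b) ->
  [/\ bnth a 0 = Some e, forall i, bnth a i.+1 = bnth b i & bend a = bend b].
Proof.
case: (pselect (erng e (bsrc b))) => eb; last by exists b.
have {}eb : bvert b 0 `<=` erng e by rewrite bvert0 => _ ->.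
case: b eb => [[s A sP AP] yP|[c cP]]; rewrite /bvert /= => eb.
  have sP' : sorted (@consec G) (e :: s).
    by case: s sP {AP yP} eb => //= f l -> fe; rewrite andbT; apply/asboolP; exact: fe.
  have AP' : ends_over (e :: s) A by case: s sP AP {yP sP'} eb.
  by exists (@BFin G (UPath sP' AP') yP).
pose d i := if i is j.+1 then c j else e.
have dP i : erng (d i) (esrc (d i.+1)) by case: i => [|i] /=; [exact: eb|exact: cP].
by exists (BInf (@IPath G d dP)).
Qed.

Definition bcons e b := projT1 (cid (bcons_subproof e b)).

Lemma bconsP e b : erng e (bsrc b) ->
  [/\ bnth (bcons e b) 0 = Some e, forall i, bnth (bcons e b) i.+1 = bnth b i &
    bend (bcons e b) = bend b].
Proof. by rewrite /bcons; case: cid. Qed.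

Lemma bconsK e b : erng e (bsrc b) -> btl (bcons e b) = b.
Proof.
move=> /bconsP[h0 hS he]; have [tn te] := btlP h0.
by apply: bpath_ext => [i|]; rewrite ?tn ?te.
Qed.

Lemma btlK e a : bnth a 0 = Some e -> bcons e (btl a) = a.
Proof.
move=> a0; have [tn te] := btlP a0; have [h0 hS he] := bconsP (bsrc_tl a0).
by apply: bpath_ext => [[|i]|]; rewrite ?h0 ?hS ?he.
Qed.

(** A boundary path without a first edge is an ultraset of [Yinf], which emits infinitely many edges
    and so cannot sit at a regular vertex. *)
Lemma bhd_regular a : regular (bsrc a) ->
  exists2 e, bnth a 0 = Some e & esrc e = bsrc a.
Proof.
move=> [_ fa]; case a0 : (bnth a 0) => [e|]; first by exists e; rewrite ?(bsrc_hd a0).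
have := bvert0 a; rewrite /bvert a0; case: a a0 fa => [y [yP yi]|//] /= _ + yE.
by rewrite -yE => /yi.
Qed.

End BoundaryPaths.

(** * The representation on functions of a boundary path and a degree *)

Section Action.
Variables (K : fieldType) (G : ultragraph).
Local Notation V := (vertex G).
Local Notation E := (edge G).
Local Notation W := (bpath G -> int -> K).
Implicit Types (a b : bpath G) (e f : E) (k : int) (phi psi : W).
Local Notation term := (term K (lpa_gen G)).

(** Generators act by pullback: s_e sends the point mass at (b, l) to the one at (e b, l + 1) if
    s(b) lies in r(e), and to 0 otherwise. *)
Definition gact (x : lpa_gen G) phi : W := fun a k =>
  match x with
  | LP A => if `[< vset_set A (bsrc a) >] then phi a k else 0
  | LS e => if bnth a 0 == Some e then phi (btl a) (k - 1) else 0
  | LSs e => if `[< erng e (bsrc a) >] then phi (bcons e a) (k + 1) else 0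
  end.

Fixpoint act (t : term) phi : W := fun a k =>
  match t with
  | Gen x => gact x phi a k
  | Zero => 0
  | Add t u => act t phi a k + act u phi a k
  | Opp t => - act t phi a k
  | Scale c t => c * act t phi a k
  | Mul t u => act t (act u phi) a k
  end.

Lemma act_eq t phi psi : (forall a k, phi a k = psi a k) ->
  forall a k, act t phi a k = act t psi a k.
Proof. by move=> h; have -> : phi = psi by apply/funext => a; exact/funext. Qed.

Lemma act_linear t c phi psi a k :
  act t (fun a k => c * phi a k + psi a k) a k = c * act t phi a k + act t psi a k.
Proof.
elim: t phi psi a k => /= [x||t IHt u IHu|t IHt|d t IHt|t IHt u IHu] phi psi a k.
- by case: x => [A|e|e] /=; case: ifP => // _; rewrite mulr0 addr0.
- by rewrite mulr0 addr0.
- by rewrite IHt IHu; ring.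
- by rewrite IHt; ring.
- by rewrite IHt; ring.
- by rewrite -IHt; apply: act_eq a k => b l; exact: IHu.
Qed.

Lemma act0 t a k : act t (fun=> fun=> 0) a k = 0.
Proof.
pose z : W := fun=> fun=> 0; have := act_linear t (-1) z z a k.
rewrite mulN1r addNr => tE; apply: etrans tE; apply: act_eq => b l.
by rewrite mulN1r addNr.
Qed.

Lemma act_sum (I : Type) (r : seq I) (F : I -> term) phi a k :
  act (foldr (@Add K _) Zero [seq F i | i <- r]) phi a k =
  \sum_(i <- r) act (F i) phi a k.
Proof. by elim: r => [|i r IH]; rewrite /= ?big_nil // big_cons IH. Qed.

Lemma act_rel t u : lpa_rel t u -> forall phi a k, act t phi a k = act u phi a k.
Proof.
case=> [|A B|A B|e|e|e|e|e f|v rv] phi a k.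
- by rewrite /=; case: asboolP.
- rewrite /=; case: (asboolP ((_ `&` _) _)) => [[Aa Ba]|nAB].
    by rewrite !asboolT.
  by case: asboolP => // Aa; case: asboolP => // Ba; case: nAB.
- rewrite /= asbool_or asbool_and; do 2![case: asboolP => _] => /=;
    rewrite ?subr0 ?add0r ?addr0 ?addrK //.
- rewrite /=; case: (bnth a 0 =P Some e) => [ae|]; last by case: ifP.
  by rewrite asboolT // (bsrc_hd ae).
- rewrite /=; case: (bnth a 0 =P Some e) => [ae|//].
  by rewrite asboolT //; exact: bsrc_tl ae.
- by rewrite /=; case: asboolP.
- rewrite /=; case: asboolP => ae //; have [h _ _] := bconsP ae.
  by rewrite asboolT //= (bsrc_hd h).
- rewrite /=; case: asboolP => ae; last by case: ifP => //=; case: asboolP.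
  have [-> _ _] := bconsP ae; rewrite bconsK // addrK (inj_eq (@Some_inj _)).
  by case: eqVneq => //= _; rewrite asboolT.
(* Cuntz-Krieger: a boundary path starting at the regular [v] has exactly one first edge, so one
   summand survives; for a path starting elsewhere all of them vanish. *)
- rewrite act_sum /=; case: asboolP => [av|nav].
    have [|e ae ea] := @bhd_regular _ a; first by rewrite av.
    rewrite (big_fsetD1 e) /=; last first.
      by rewrite in_fset_set; [apply/mem_set; rewrite /emitted /= ea av|exact: rv.2].
    rewrite ae eqxx asboolT; last exact: bsrc_tl ae.
    rewrite btlK // subrK big1_fset ?addr0 // => f.
    by rewrite in_fsetD1 => /andP[fe _] _;
      rewrite (inj_eq (@Some_inj _)) eq_sym (negPf fe).
  rewrite big1_fset // => f; rewrite in_fset_set; last exact: rv.2.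
  move=> /set_mem fv _.
  by case: (bnth a 0 =P Some f) => // /bsrc_hd af; case: nav; rewrite /= af fv.
Qed.

Lemma act_cong t u : cong (@lpa_rel G K) t u ->
  forall phi a k, act t phi a k = act u phi a k.
Proof.
elim=> {t u} /= [t u tu|t|t u _ IH|u t w _ IH1 _ IH2|t t' u u' _ IH1 _ IH2
  |t t' _ IH|c t t' _ IH|t t' u u' _ IH1 _ IH2|t u w|t u|t|t|c d t|t|c t u|c d t
  |t u w|t u w|t u w|c t u|c t u] phi a k //; try ring.
- exact: act_rel.
- by rewrite IH1 IH2.
- by rewrite IH1 IH2.
- by rewrite IH.
- by rewrite IH.
- by rewrite IH1; apply: act_eq.
(* Sums and scalars in the right factor of a product pass through the left factor by linearity of
   the action in [phi]. *)
- rewrite -[X in _ = X + _]mul1r -act_linear; apply: act_eq => b l.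
  by rewrite mul1r.
- rewrite -[LHS]addr0 -(act0 t a k) -act_linear; apply: act_eq => b l.
  by rewrite addr0.
Qed.

Definition delta b l : W := fun c k => (`[< c = b >] && (k == l))%:R.

(** For an arrow (a, k, b), this is the matrix coefficient of [t] from the point (b, 0) to the point
    (a, k). *)
Definition coef (t : term) (g : arrow G) : K^o :=
  act t (delta (asrc g) 0) (arng g) (adeg g).

Definition lpa_repr (x : lpa G K) : arrow G -> K^o := coef (prepr x).

Lemma lpa_reprE t : lpa_repr (pclass _ t) = coef t.
Proof. by apply/funext => g; apply: act_cong; exact: preprP. Qed.

Lemma lpa_repr_linear : linear lpa_repr.
Proof.
move=> c; elim/pclass_ind=> t; elim/pclass_ind=> u.
have -> : c *: pclass _ t + pclass _ u = pclass (@lpa_rel G K) (Add (Scale c t) u).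
  by rewrite -paddE -pscaleE.
by rewrite !lpa_reprE.
Qed.

HB.instance Definition _ := GRing.isLinear.Build K (lpa G K) (arrow G -> K^o)
  *:%R lpa_repr lpa_repr_linear.

End Action.

(** * Products become convolutions *)

Section Convolution.
Variables (K : fieldType) (G : ultragraph).
Implicit Types (a b : bpath G) (e : edge G) (k : int).
Local Notation term := (term K (lpa_gen G)).

Lemma arrow_tl a e : bnth a 0 = Some e -> arrowp a 1 (btl a).
Proof.
move=> a0; have [tn te] := btlP a0; apply/arrowpP; exists 1%N, 0%N.
by split => //; case=> // _; rewrite a0.
Qed.

Lemma arrow_cons e a : erng e (bsrc a) -> arrowp a (-1) (bcons e a).
Proof.
move=> ea; have [h0 _ _] := bconsP ea.
by have := arrowp_inv (arrow_tl h0); rewrite bconsK.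
Qed.

(* Each value of [act t phi] is a finite combination of values of [phi] at
   points of the same orbit; this makes the convolution sums finite. *)
Lemma act_finite (t : term) a : exists2 s : seq (K * arrow G),
  (forall p, p \in s -> arng p.2 = a) &
  forall phi k, act t phi a k = \sum_(p <- s) p.1 * phi (asrc p.2) (k - adeg p.2).
Proof.
elim: t a => [x||t IHt u IHu|t IHt|c t IHt|t IHt u IHu] a.
- have nil : (forall phi k, gact x phi a k = 0 :> K) ->
    exists2 s : seq (K * arrow G), (forall p, p \in s -> arng p.2 = a) &
    forall phi k, gact x phi a k = \sum_(p <- s) p.1 * phi (asrc p.2) (k - adeg p.2).
    by move=> h; exists [::] => // phi k; rewrite big_nil.
  have one (g : arrow G) : arng g = a ->
    (forall phi k, gact x phi a k = phi (asrc g) (k - adeg g) :> K) ->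
    exists2 s : seq (K * arrow G), (forall p, p \in s -> arng p.2 = a) &
    forall phi k, gact x phi a k = \sum_(p <- s) p.1 * phi (asrc p.2) (k - adeg p.2).
    move=> ga h; exists [:: (1, g)] => [p|phi k].
      by rewrite mem_seq1 => /eqP ->.
    by rewrite big_seq1 mul1r.
  rewrite /act; case: x nil one => [A|e|e] /=.
  + case: asboolP => aA nil one; last exact: nil.
    by apply: (one (aunit a)) => // phi k; rewrite subr0.
  + case: eqP => a0 nil one; last exact: nil.
    exact: (one (Arrow (arrow_tl a0))).
  + case: asboolP => ea nil one; last exact: nil.
    by apply: (one (Arrow (arrow_cons ea))) => // phi k; rewrite opprK.
- by exists [::] => // phi k; rewrite big_nil.
- have [s sa sE] := IHt a; have [r ra rE] := IHu a.
  exists (s ++ r) => [p|phi k]; first by rewrite mem_cat => /orP[/sa|/ra].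
  by rewrite /= sE rE big_cat.
- have [s sa sE] := IHt a; exists [seq (- p.1, p.2) | p <- s] => [p|phi k].
    by move=> /mapP[q /sa qa ->].
  by rewrite /= sE big_map -sumrN; apply: eq_bigr => p _; rewrite mulNr.
- have [s sa sE] := IHt a; exists [seq (c * p.1, p.2) | p <- s] => [p|phi k].
    by move=> /mapP[q /sa qa ->].
  by rewrite /= sE big_map mulr_sumr; apply: eq_bigr => p _; rewrite mulrA.
- have [s sa sE] := IHt a.
  pose r b := projT1 (cid2 (IHu b)).
  have rP b p : p \in r b -> arng p.2 = b by rewrite /r; case: cid2 => ? /= + _; exact.
  have rE b phi k :
      act u phi b k = \sum_(p <- r b) p.1 * phi (asrc p.2) (k - adeg p.2).
    by rewrite /r; case: cid2 => ? /= _ ->.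
  exists [seq (p.1 * q.1, amul p.2 q.2) | p <- s, q <- r (asrc p.2)].
    move=> _ /allpairsPdep[p [q [ps qr ->]]] /=.
    by have [-> _ _] := amulE (esym (rP _ _ qr)); exact: sa.
  move=> phi k; rewrite /= sE big_allpairs_dep; apply: eq_bigr => p _ /=.
  rewrite rE mulr_sumr big_seq [RHS]big_seq; apply: eq_bigr => q qr.
  have [_ -> ->] := amulE (esym (rP _ _ qr)).
  by rewrite mulrA opprD addrA.
Qed.

(** The first factor of [c] determines the second, so a convolution at [c] is a sum over the arrows
    with the range of [c]. *)
Lemma arrow_factor (x y c : arrow G) :
  gsrc (ultragraph_groupoid G) x = grng (ultragraph_groupoid G) y /\ amul x y = c <->
  arng x = arng c /\ y = amul (ainv x) c.
Proof.
split=> [[/aunit_inj xy <-]|[xc ->]].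
  have [r d s] := amulE xy; have [|r' d' s'] := @amulE _ (ainv x) (amul x y).
    by rewrite r.
  by split=> //; apply: arrow_inj; rewrite ?r' ?d' ?s' //= d addKr.
have [r d s] := @amulE _ (ainv x) c xc; rewrite /= in r d s.
have [|r' d' s'] := @amulE _ x (amul (ainv x) c); first by rewrite r.
split; first by rewrite /= /agsrc /agrng r.
by apply: arrow_inj; rewrite ?r' ?d' ?s' ?d ?addNKr // addrA subrr add0r.
Qed.

Lemma convolutionE (f h : arrow G -> K^o) c :
  convolution (ultragraph_groupoid G) f h c =
  \sum_(x \in [set x | arng x = arng c]) f x * h (amul (ainv x) c).
Proof.
rewrite /convolution (@reindex_fsbig _ _ _ _ _ (fun x => (x, amul (ainv x) c))
  [set x | arng x = arng c]) //.
split=> [x xc|x y _ _ [//]|[x y] /arrow_factor/=[xc ->]].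
  by apply/arrow_factor.
by exists x.
Qed.

Lemma coef_mul t u :
  coef (Mul t u) = convolution (ultragraph_groupoid G) (@coef K G t) (coef u).
Proof.
apply/funext => c; rewrite convolutionE.
have [s sa sE] := act_finite t (arng c).
(* On the arrows with the range of [c], [coef t] is a finite combination of point masses. *)
have tE x : arng x = arng c -> coef t x = \sum_(p <- s) p.1 * (p.2 == x)%:R.
  move=> xc; rewrite /coef xc sE [LHS]big_seq [RHS]big_seq; apply: eq_bigr => p ps.
  congr (_ * _); rewrite /delta subr_eq0; congr ((nat_of_bool _)%:R).
  apply/andP/eqP => [[/asboolP px /eqP dx]|->]; last by rewrite asboolT.
  by apply: arrow_inj; rewrite ?(sa _ ps).
(* [s] may list an arrow several times; the convolution runs over the distinct ones, which contain
   the support, and exchanging the two sums recovers the weights. *)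
pose r := undup [seq p.2 | p <- s].
have rc x : x \in r -> arng x = arng c by rewrite mem_undup => /mapP[p /sa + ->].
rewrite (fsbigE r) ?undup_uniq //; last first.
  move=> x xc; rewrite mem_undup => xr; rewrite tE // big_seq big1 ?mul0r // => p ps.
  case: eqP => px; last by rewrite mulr0.
  by case/negP: xr; rewrite -px; exact: map_f.
rewrite [LHS]/coef /= sE [RHS]big_seq_cond.
under [RHS]eq_bigr => x /andP[xr _].
  rewrite (tE _ (rc _ xr)) mulr_suml; under eq_bigr do rewrite -mulrA; over.
transitivity (\sum_(x <- r) \sum_(p <- s)
    p.1 * ((p.2 == x)%:R * coef u (amul (ainv x) c))).
  rewrite exchange_big /=; rewrite big_seq [RHS]big_seq; apply: eq_bigr => p ps.
  have pr : p.2 \in r by rewrite mem_undup map_f.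
  rewrite (bigD1_seq p.2) ?undup_uniq //= eqxx mul1r [X in _ = _ + X]big1; last first.
    by move=> x; rewrite eq_sym => /negPf ->; rewrite mul0r mulr0.
  have [r' d' s'] := @amulE _ (ainv p.2) c (sa _ ps).
  by rewrite addr0 /coef r' d' s' /= addrC.
rewrite big_seq; apply: eq_bigl => x; case xr : (x \in r) => //=.
by rewrite mem_set //=; exact: rc.
Qed.

Lemma lpa_repr_mul (x y : lpa G K) : lpa_repr (lpa_mul x y) =
  convolution (ultragraph_groupoid G) (lpa_repr x) (lpa_repr y).
Proof.
elim/pclass_ind: x => t; elim/pclass_ind: y => u.
by rewrite /lpa_mul pmulE !lpa_reprE coef_mul.
Qed.

End Convolution.

(** * The spanning monomials and their images *)

Section Monomials.
Variables (K : fieldType) (G : ultragraph).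
Implicit Types (a b : bpath G) (e f : edge G) (k l : int) (A B : vset G).
Implicit Types (al be : seq (edge G)) (v : vertex G) (x y z : lpa G K).
Local Notation p A := (lpa_p K A).
Local Notation s e := (lpa_s K e).
Local Notation s' e := (lpa_s' K e).

Lemma lpa_mulA x y z : lpa_mul x (lpa_mul y z) = lpa_mul (lpa_mul x y) z.
Proof. exact: pmulA. Qed.

Lemma lpa_mulDl x y z : lpa_mul (x + y) z = lpa_mul x z + lpa_mul y z.
Proof. exact: pmulDl. Qed.

Lemma lpa_mulDr x y z : lpa_mul z (x + y) = lpa_mul z x + lpa_mul z y.
Proof. exact: pmulDr. Qed.

Lemma lpa_mulZl (c : K) x y : lpa_mul (c *: x) y = c *: lpa_mul x y.
Proof. by rewrite /lpa_mul pscaleAl. Qed.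

Lemma lpa_mulZr (c : K) x y : lpa_mul x (c *: y) = c *: lpa_mul x y.
Proof. by rewrite /lpa_mul pscaleAr. Qed.

Lemma lpa_mul0l x : lpa_mul 0 x = 0.
Proof. by have := lpa_mulZl 0 0 x; rewrite !scale0r. Qed.

Lemma lpa_mul0r x : lpa_mul x 0 = 0.
Proof. by have := lpa_mulZr 0 x 0; rewrite !scale0r. Qed.

Lemma lpa_p0 : p (vset0 G) = 0.
Proof. by apply/pclassP/cong_rel/lpa_p0. Qed.

Lemma lpa_pI A B : lpa_mul (p A) (p B) = p (vsetI A B).
Proof. by rewrite /lpa_mul pmulE; apply/pclassP/cong_rel/lpa_pI. Qed.

Lemma lpa_pU A B : p (vsetU A B) = p A + p B - p (vsetI A B).
Proof.
rewrite -[p A + p B]/(padd _ _) -[- _]/(popp _) paddE poppE -[LHS]/(pclass _ _).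
by rewrite -[RHS]/(padd _ _) paddE; apply/pclassP/cong_rel/lpa_pU.
Qed.

Lemma lpa_s_rng e : lpa_mul (s e) (p (vrng e)) = s e.
Proof. by rewrite /lpa_mul pmulE; apply/pclassP/cong_rel/lpa_sp. Qed.

Lemma lpa_rng_s' e : lpa_mul (p (vrng e)) (s' e) = s' e.
Proof. by rewrite /lpa_mul pmulE; apply/pclassP/cong_rel/lpa_ps'. Qed.

Lemma lpa_s's e f : lpa_mul (s' e) (s f) = if e == f then p (vrng e) else 0.
Proof.
rewrite /lpa_mul pmulE; transitivity (pclass (@lpa_rel G K)
    (if e == f then Gen (LP (vrng e)) else Zero)); last by case: ifP.
by apply/pclassP/cong_rel/lpa_s's.
Qed.

(** Writing s_e as p_v s_e with v = s(e) reduces this to the intersection of A with {v}, which is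
    {v} or empty. *)
Lemma lpa_p_s A e :
  lpa_mul (p A) (s e) = if `[< vset_set A (esrc e) >] then s e else 0.
Proof.
have es : lpa_mul (p (vset1 (esrc e))) (s e) = s e.
  by rewrite /lpa_mul pmulE; apply/pclassP/cong_rel/lpa_ps.
rewrite -es lpa_mulA lpa_pI; case: asboolP => Ae.
  by congr (lpa_mul (p _) _); apply: vset_inj; apply/setIidPr => _ ->.
suff -> : vsetI A (vset1 (esrc e)) = vset0 G by rewrite lpa_p0 lpa_mul0l.
by apply: vset_inj; apply/seteqP; split=> // _ /= [] /[swap] ->.
Qed.

Lemma lpa_s'_p A e :
  lpa_mul (s' e) (p A) = if `[< vset_set A (esrc e) >] then s' e else 0.
Proof.
have es : lpa_mul (s' e) (p (vset1 (esrc e))) = s' e.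
  by rewrite /lpa_mul pmulE; apply/pclassP/cong_rel/lpa_s'p.
rewrite -es -lpa_mulA lpa_pI; case: asboolP => Ae.
  by congr (lpa_mul _ (p _)); apply: vset_inj; apply/setIidPl => _ ->.
suff -> : vsetI (vset1 (esrc e)) A = vset0 G by rewrite lpa_p0 lpa_mul0r.
by apply: vset_inj; apply/seteqP; split=> // _ /= [] ->.
Qed.

Lemma lpa_ck v : regular v ->
  p (vset1 v) = \sum_(e <- fset_set (emitted [set v])) lpa_mul (s e) (s' e).
Proof.
move=> rv; transitivity (pclass (@lpa_rel G K) (foldr (@Add K _) Zero
    [seq Mul (Gen (LS e)) (Gen (LSs e)) | e <- fset_set (emitted [set v])])).
  by apply/pclassP/cong_rel/lpa_ck.
elim: (enum_fset _) => [|e r IH]; first by rewrite big_nil.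
by rewrite big_cons -IH /lpa_mul pmulE -[RHS]/(padd _ _) paddE.
Qed.

Definition lmon al x := foldr (fun e y => lpa_mul (s e) y) x al.
Definition rmon x be := foldr (fun e y => lpa_mul y (s' e)) x be.

(* The element s_al p_A s_be^*. *)
Definition mon al A be := lmon al (rmon (p A) be).

Lemma mul_rmon x y be : lpa_mul x (rmon y be) = rmon (lpa_mul x y) be.
Proof. by elim: be => //= e be IH; rewrite lpa_mulA IH. Qed.

Lemma lmon_linear al c x y : lmon al (c *: x + y) = c *: lmon al x + lmon al y.
Proof. by elim: al => //= e al ->; rewrite lpa_mulDr lpa_mulZr. Qed.

Lemma rmon_linear be c x y : rmon (c *: x + y) be = c *: rmon x be + rmon y be.
Proof. by elim: be => //= e be ->; rewrite lpa_mulDl lpa_mulZl. Qed.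

Lemma lmon0 al : lmon al 0 = 0.
Proof. by elim: al => //= e al ->; rewrite lpa_mul0r. Qed.

Lemma rmon0 be : rmon 0 be = 0.
Proof. by elim: be => //= e be ->; rewrite lpa_mul0l. Qed.

Lemma mon_edge e : mon [:: e] (vrng e) [::] = s e.
Proof. exact: lpa_s_rng. Qed.

Lemma mon_edge' e : mon [::] (vrng e) [:: e] = s' e.
Proof. exact: lpa_rng_s'. Qed.

Definition monomials : set (lpa G K) := [set x | exists al A be, x = mon al A be].

Lemma p_mon B al A be : lin_span monomials (lpa_mul (p B) (mon al A be)).
Proof.
rewrite /mon; case: al => [|e al] /=.
  by rewrite mul_rmon lpa_pI; apply: lin_span_gen; exists [::], (vsetI B A), be.
rewrite lpa_mulA lpa_p_s; case: asboolP => _.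
  by apply: lin_span_gen; exists (e :: al), A, be.
by rewrite lpa_mul0l; exact: lin_span0.
Qed.

Lemma s'_mon e al A be : lin_span monomials (lpa_mul (s' e) (mon al A be)).
Proof.
rewrite /mon; case: al => [|f al] /=.
  rewrite mul_rmon lpa_s'_p; case: asboolP => _; last first.
    by rewrite rmon0; exact: lin_span0.
  (* The new edge goes to the end of [be], since s_e^* s_be^* is the adjoint of s_be s_e. *)
  rewrite -mon_edge'; apply: lin_span_gen; exists [::], (vrng e), (be ++ [:: e]).
  by rewrite /mon /= /rmon foldr_cat.
rewrite lpa_mulA lpa_s's; case: ifP => _; first exact: p_mon.
by rewrite lpa_mul0l; exact: lin_span0.
Qed.

(** The span of the monomials contains the generators and is stable under left multiplication by
    each of them, hence by every term; so it is closed under products. *)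
Lemma lpa_span x : lin_span monomials x.
Proof.
have mul (t : term K (lpa_gen G)) y : lin_span monomials y ->
    lin_span monomials (lpa_mul (pclass _ t) y).
  elim: t y => [u||t IHt u IHu|t IHt|c t IHt|t IHt u IHu] y.
  - move: y; apply: lin_span_ind => [|y z Sy Sz|c y Sy|_ [al [A [be ->]]]].
    + by rewrite lpa_mul0r; exact: lin_span0.
    + by rewrite lpa_mulDr; exact: lin_spanD.
    + by rewrite lpa_mulZr; exact: lin_spanZ.
    + case: u => [B|e|e]; [exact: p_mon| |exact: s'_mon].
      by apply: lin_span_gen; exists (e :: al), A, be.
  - by rewrite -[pclass _ Zero]/(0 : lpa G K) lpa_mul0l => _; exact: lin_span0.
  - rewrite -paddE -[padd _ _]/(_ + _ : lpa G K) lpa_mulDl => Sy.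
    by apply: lin_spanD; [exact: IHt|exact: IHu].
  - rewrite -poppE -[popp _]/(- _ : lpa G K) -scaleN1r lpa_mulZl => Sy.
    by apply: lin_spanZ; exact: IHt.
  - rewrite -pscaleE -[pscale _ _]/(_ *: _ : lpa G K) lpa_mulZl => Sy.
    by apply: lin_spanZ; exact: IHt.
  - rewrite -pmulE -[pmul _ _]/(lpa_mul _ _) -lpa_mulA => Sy.
    by apply: IHt; exact: IHu.
elim/pclass_ind: x; elim=> [u||t IHt u IHu|t IHt|c t IHt|t IHt u IHu].
- apply: lin_span_gen; case: u => [A|e|e]; first by exists [::], A, [::].
    by exists [:: e], (vrng e), [::]; rewrite mon_edge.
  by exists [::], (vrng e), [:: e]; rewrite mon_edge'.
- exact: lin_span0.
- by rewrite -paddE; exact: lin_spanD.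
- by rewrite -poppE -[popp _]/(- _ : lpa G K) -scaleN1r; exact: lin_spanZ.
- by rewrite -pscaleE; exact: lin_spanZ.
- by rewrite -pmulE; exact: mul.
Qed.

Definition lpa_act x (phi : bpath G -> int -> K) := act (prepr x) phi.

Lemma lpa_act_gen (u : lpa_gen G) phi a k :
  lpa_act (pgen _ u) phi a k = gact u phi a k.
Proof. by rewrite /lpa_act (act_cong (preprP _ _)). Qed.

Lemma lpa_actM x y phi a k : lpa_act (lpa_mul x y) phi a k =
  lpa_act x (lpa_act y phi) a k.
Proof. by rewrite /lpa_act (act_cong (preprP _ _)). Qed.

Fixpoint bpre al a := if al is e :: al' then
  (bnth a 0 == Some e) && bpre al' (btl a) else true.

Definition bdrop n a := iter n (@btl G) a.

Lemma bdropS n a : bdrop n.+1 a = bdrop n (btl a).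
Proof. exact: iterSr. Qed.

Lemma lpa_act_lmon al x phi a k : lpa_act (lmon al x) phi a k =
  if bpre al a then lpa_act x phi (bdrop (size al) a) (k - (size al)%:Z) else 0.
Proof.
elim: al a k => [|e al IH] a k /=; first by rewrite subr0.
rewrite lpa_actM lpa_act_gen /=; case: eqP => //= _.
rewrite IH; case: ifP => // _; congr (lpa_act _ _ _ _); first by rewrite /bdrop -iterSr.
by lia.
Qed.

(** Because [bcons e] and [btl] are mutually inverse on paths starting with [e], s_e^* moves a point
    mass to the tail. *)
Lemma gact_delta e b l a k : gact (LSs e) (delta K b l) a k =
  if bnth b 0 == Some e then delta K (btl b) (l - 1) a k else 0.
Proof.
rewrite /gact /delta -[k == l - 1]subr_eq0 -[k + 1 == l]subr_eq0 opprB addrA.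
case: asboolP => ea; last first.
  case: (bnth b 0 =P Some e) => // b0; case: asboolP => // ab.
  by case: ea; rewrite ab; exact: bsrc_tl b0.
case: asboolP => [ab|nab].
  have [h0 _ _] := bconsP ea.
  by rewrite -ab h0 eqxx bconsK // asboolT.
case: (bnth b 0 =P Some e) => // b0; case: asboolP => // ab.
by case: nab; rewrite ab btlK.
Qed.

Lemma lpa_act_rmon x be b l a k : lpa_act (rmon x be) (delta K b l) a k =
  if bpre be b then
    lpa_act x (delta K (bdrop (size be) b) (l - (size be)%:Z)) a k
  else 0.
Proof.
elim: be b l => [|e be IH] b l /=; first by rewrite subr0.
rewrite lpa_actM; transitivity (lpa_act (rmon x be)
    (fun c m => if bnth b 0 == Some e then delta K (btl b) (l - 1) c m else 0) a k).
  apply: act_eq => c m; rewrite lpa_act_gen; exact: gact_delta.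
case: eqP => _ /=; last exact: act0.
rewrite IH; case: ifP => // _; rewrite /bdrop -iterSr.
by congr (lpa_act _ (delta _ _ _) _ _); lia.
Qed.

(* The set of arrows (al mu, |al| - |be|, be mu) with s(mu) in A. *)
Definition mon_set al A be : set (arrow G) := [set g |
  [/\ bpre al (arng g), bpre be (asrc g),
      bdrop (size al) (arng g) = bdrop (size be) (asrc g),
      vset_set A (bsrc (bdrop (size al) (arng g))) &
      adeg g = (size al)%:Z - (size be)%:Z]].

(** Stripping [al] from the range and [be] from the source leaves a coefficient of p_A, which
    compares the two tails and the degrees and tests whether the source of the tail is in A. *)
Lemma mon_repr al A be : lpa_repr (mon al A be) = \1_(mon_set al A be).
Proof.
apply/funext => g; rewrite indicE -[LHS]/(lpa_act _ _ _ _) /mon lpa_act_lmon.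
have -> : (g \in mon_set al A be) = [&& bpre al (arng g), bpre be (asrc g),
    `[< bdrop (size al) (arng g) = bdrop (size be) (asrc g) >],
    `[< vset_set A (bsrc (bdrop (size al) (arng g))) >] &
    adeg g == (size al)%:Z - (size be)%:Z].
  apply/idP/and5P => [/set_mem[-> -> ? ? ->]|[? ? /asboolP ? /asboolP ? /eqP ?]].
    by split => //; exact/asboolP.
  exact/mem_set.
case: ifP => //= _; rewrite lpa_act_rmon; case: ifP => //= _.
rewrite lpa_act_gen /= /delta sub0r.
have -> : (adeg g - (size al)%:Z == - (size be)%:Z) =
          (adeg g == (size al)%:Z - (size be)%:Z) by lia.
by case: (asboolP (vset_set A _)) => _ /=; rewrite ?andbF.
Qed.

End Monomials.

(** * Prefixes and existence of boundary paths *)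

Section BoundaryPathExistence.
Variable G : ultragraph.
Hypothesis no_sinks : forall v : vertex G, ~ sink v.
Implicit Types (a b : bpath G) (al be : seq (edge G)) (v : vertex G).

Lemma bpreP al a : bpre al a ->
  [/\ forall i, (i < size al)%N -> bnth a i = onth al i,
      forall i, bnth (bdrop (size al) a) i = bnth a (size al + i) &
      bend (bdrop (size al) a) = bend a].
Proof.
elim: al a => [//|e al IH] a /andP[/eqP a0 /IH[hi hd he]].
have [tn te] := btlP a0; split=> [[|i] // ia|i|].
- by rewrite -tn hi.
- by rewrite [size _]/= bdropS hd tn.
- by rewrite [size _]/= bdropS he.
Qed.

Lemma bpre_nth al a :
  (forall i, (i < size al)%N -> bnth a i = onth al i) -> bpre al a.
Proof.
elim: al a => [//|e al IH] a h /=; have a0 := h 0%N isT; rewrite a0 eqxx /=.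
by have [tn _] := btlP a0; apply: IH => i ia; rewrite tn h.
Qed.

Lemma bpre_inj al be a : bpre al a -> bpre be a -> size al = size be -> al = be.
Proof.
elim: al be a => [|e al IH] [|f be] a //= /andP[/eqP a0 pa] /andP[/eqP b0 pb] [ss].
by move: b0; rewrite a0 => -[<-]; rewrite (IH _ _ pa pb ss).
Qed.

Lemma bvert_bdrop al a : bpre al a ->
  bvert a (size al) = [set bsrc (bdrop (size al) a)].
Proof. by move=> /bpreP[_ hd he]; rewrite -bvert0 /bvert hd addn0 he. Qed.

(** A member avoiding [v], in a filter that contains {v}, would meet {v} in the empty set. *)
Lemma ultraset1 v : ultraset (vset1 v).
Proof.
split.
  split=> [B []//|[_ /(_ v)]|A B [GA Av] [GB Bv]|A B [GA Av] GB AB]; first exact.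
    by split; [exact: inG0_I|move=> w vw; split; [exact: Av|exact: Bv]].
  by split=> //; exact: subset_trans AB.
move=> F [FG F0 FI _] vF; apply/seteqP; split=> // B FB; split; first exact: FG.
move=> _ ->; apply: contrapT => nBv; apply: F0.
suff <- : B `&` [set v] = set0 by apply: FI => //; apply: vF; split => //; exact: inG0_1.
by apply/seteqP; split => // _ [] /[swap] ->.
Qed.

(** An infinite emitter is itself a boundary path of length 0. From a finite emitter, alternately
    choosing an edge out of a vertex and a vertex in its range gives an infinite path, as there are
    no sinks. *)
Lemma bpath_exists v : exists a,
  bsrc a = v /\ (infinite_set (emitted [set v]) -> bnth a 0 = None).
Proof.
case: (pselect (finite_set (emitted [set v]))) => [fv|iv]; last first.
  have yv : Yinf (uvset (vset1 v)) by split; [exact: ultraset1|].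
  exists (BFin yv); split => //.
  have : [set bsrc (BFin yv)] = [set v] by rewrite -bvert0.
  by move=> /seteqP[/(_ _ erefl)].
have emit u : exists e, esrc e = u :> vertex G.
  by have /eqP/set0P[e eu] := @no_sinks u; exists e.
pose out u := projT1 (cid (emit u)).
have outP u : esrc (out u) = u by rewrite /out; case: cid.
pose in_ e := projT1 (cid (@erng_neq0 G e)).
have in_P e : erng e (in_ e) by rewrite /in_; case: cid.
have cP i : erng (iter i (out \o in_) (out v)) (esrc (iter i.+1 (out \o in_) (out v))).
  by rewrite iterS /= outP.
exists (BInf (@IPath G (fun i => iter i (out \o in_) (out v)) cP)); split=> [|[] //].
by rewrite (@bsrc_hd _ _ (out v)) //= outP.
Qed.

Definition vsrc al v := if al is e :: _ then esrc e else v.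

(** States that [al] is a path whose range contains [v], the condition under which s_al p_v need not
    vanish. *)
Fixpoint vpath al v : Prop := if al is e :: al' then
  erng e (vsrc al' v) /\ vpath al' v else True.

Lemma bpath_extend al a : vpath al (bsrc a) ->
  exists2 b, bpre al b & bdrop (size al) b = a.
Proof.
(* The source of the extension is carried along, since prefixing the next edge depends on it. *)
suff h : vpath al (bsrc a) ->
    exists b, [/\ bpre al b, bdrop (size al) b = a & bsrc b = vsrc al (bsrc a)].
  by move=> /h[b [? ? _]]; exists b.
elim: al => [_|e al IH /= [es /IH[b [pb db sb]]]]; first by exists a.
rewrite -sb in es; have [h0 _ _] := bconsP es.
exists (bcons e b); rewrite h0 eqxx bconsK // (bsrc_hd h0) -iterS -/(bdrop _ _).
by rewrite bdropS bconsK.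
Qed.

End BoundaryPathExistence.

(** * Injectivity by separating monomials of one level *)

Section Injectivity.
Variables (K : fieldType) (G : ultragraph).
Hypothesis no_sinks : forall v : vertex G, ~ sink v.
Hypothesis vset_finite : forall A : vset G, finite_set A.
Implicit Types (a b : bpath G) (e f : edge G) (k l : int) (A B : vset G).
Implicit Types (al be : seq (edge G)) (v : vertex G) (x y z : lpa G K).
Local Notation p A := (lpa_p K A).
Local Notation s e := (lpa_s K e).
Local Notation s' e := (lpa_s' K e).

Lemma lmon_sum (I : Type) (r : seq I) (F : I -> lpa G K) al :
  lmon al (\sum_(i <- r) F i) = \sum_(i <- r) lmon al (F i).
Proof.
apply: (big_morph (lmon al)) => [x y|]; last exact: lmon0.
by have := lmon_linear al 1 x y; rewrite !scale1r.
Qed.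

Lemma rmon_sum (I : Type) (r : seq I) (F : I -> lpa G K) be :
  rmon (\sum_(i <- r) F i) be = \sum_(i <- r) rmon (F i) be.
Proof.
apply: (big_morph (fun x => rmon x be)) => [x y|]; last exact: rmon0.
by have := rmon_linear be 1 x y; rewrite !scale1r.
Qed.

(** The union relation is iterated over the finitely many points of A; each correction term is p of
    an empty intersection. Each partial union is built as a member of G^0 together with its sum. *)
Lemma lpa_p_sum A : p A = \sum_(v <- fset_set A) p (vset1 v).
Proof.
have seqE (r : seq (vertex G)) : uniq r -> exists2 B : vset G,
    vset_set B = [set` r] & p B = \sum_(v <- r) p (vset1 v).
  elim: r => [_|v r IH /= /andP[vr /IH[B BE Bp]]].
    by exists (vset0 G); [apply/seteqP; split|rewrite lpa_p0 big_nil].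
  exists (vsetU (vset1 v) B).
    rewrite /= BE; apply/seteqP; split=> w /=; rewrite inE.
      by move=> [->|->]; rewrite ?eqxx ?orbT.
    by move=> /orP[/eqP|]; [left|right].
  rewrite lpa_pU big_cons -Bp (_ : vsetI _ _ = vset0 G) ?lpa_p0 ?subr0 //.
  apply: vset_inj; rewrite /= BE; apply/seteqP; split=> // w /= [-> wr].
  by rewrite wr in vr.
have [B BE <-] := seqE _ (fset_uniq (fset_set A)).
by congr (p _); apply: vset_inj; rewrite BE fset_setK.
Qed.

Lemma mon_sum al A be : mon K al A be = \sum_(v <- fset_set A) mon K al (vset1 v) be.
Proof. by rewrite /mon lpa_p_sum rmon_sum lmon_sum. Qed.

Lemma mon_ck al v be : regular v -> mon K al (vset1 v) be =
  \sum_(e <- fset_set (emitted [set v])) mon K (al ++ [:: e]) (vrng e) (be ++ [:: e]).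
Proof.
move=> rv; rewrite /mon lpa_ck // rmon_sum lmon_sum; apply: eq_bigr => e _.
by rewrite /lmon /rmon !foldr_cat /= -/(rmon _ _) mul_rmon lpa_rng_s'.
Qed.

Lemma p_vsrc_lmon al v y :
  lpa_mul (p (vset1 (vsrc al v))) (lmon al (lpa_mul (p (vset1 v)) y)) =
  lmon al (lpa_mul (p (vset1 v)) y).
Proof.
case: al => [|e al] /=; rewrite lpa_mulA; last by rewrite lpa_p_s asboolT.
by rewrite lpa_pI; congr (lpa_mul (p _) _); apply: vset_inj; exact: setIid.
Qed.

Lemma rmon_p_vsrc be v y :
  lpa_mul (rmon (lpa_mul y (p (vset1 v))) be) (p (vset1 (vsrc be v))) =
  rmon (lpa_mul y (p (vset1 v))) be.
Proof.
case: be => [|e be] /=; rewrite -lpa_mulA; last by rewrite lpa_s'_p asboolT.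
by rewrite lpa_pI; congr (lpa_mul _ (p _)); apply: vset_inj; exact: setIid.
Qed.

Lemma lpa_p_disj A B : A `&` B = set0 -> lpa_mul (p A) (p B) = 0.
Proof.
by move=> AB; rewrite lpa_pI -lpa_p0; congr (p _); exact: vset_inj.
Qed.

(** Where [al] fails to be a path, s_e = s_e p_{r(e)} meets a projection p_w with w outside r(e),
    and these two projections are orthogonal. *)
Lemma lmon_vpath al v y : ~ vpath al v -> lmon al (lpa_mul (p (vset1 v)) y) = 0.
Proof.
elim: al => [[]//|e al IH] /= /not_andP[ev|/IH ->]; last exact: lpa_mul0r.
rewrite -p_vsrc_lmon -lpa_s_rng -lpa_mulA [X in lpa_mul _ X]lpa_mulA lpa_p_disj.
  by rewrite lpa_mul0l lpa_mul0r.
by apply/seteqP; split=> // _ [] /[swap] ->.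
Qed.

Lemma rmon_vpath be v y : ~ vpath be v -> rmon (lpa_mul y (p (vset1 v))) be = 0.
Proof.
elim: be => [[]//|e be IH] /= /not_andP[ev|/IH ->]; last exact: lpa_mul0l.
rewrite -rmon_p_vsrc -lpa_rng_s' -lpa_mulA [X in lpa_mul _ X]lpa_mulA lpa_p_disj.
  by rewrite lpa_mul0l lpa_mul0r.
by apply/seteqP; split=> // _ [] ->.
Qed.

(** When [al] and [be] are paths into [v], the witness is (al m, |al| - |be|, be m) with m a
    boundary path at [v], of length 0 if [v] is an infinite emitter. *)
Lemma mon_witness al v be : mon K al (vset1 v) be = 0 \/
  exists2 g, mon_set al (vset1 v) be g &
    infinite_set (emitted [set v]) -> bnth (bdrop (size al) (arng g)) 0 = None.
Proof.
(* Doubling the projection puts the monomial in the form of [lmon_vpath] and [rmon_vpath]. *)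
have pp : p (vset1 v) = lpa_mul (p (vset1 v)) (p (vset1 v)).
  by rewrite lpa_pI; congr (p _); apply: vset_inj; rewrite /= setIid.
case: (pselect (vpath al v)) => [alv|nv]; last first.
  by left; rewrite /mon pp -mul_rmon lmon_vpath.
case: (pselect (vpath be v)) => [bev|nv]; last first.
  by left; rewrite /mon pp rmon_vpath // lmon0.
right; have [m [mv mi]] := bpath_exists no_sinks v.
rewrite -mv in alv bev; have [a pa da] := bpath_extend alv.
have [b pb db] := bpath_extend bev.
have gP : arrowp a ((size al)%:Z - (size be)%:Z) b.
  have [ha hda hea] := bpreP pa; have [hb hdb heb] := bpreP pb.
  apply/arrowpP; exists (size al), (size be); split => //.
  - by move=> i ia; rewrite ha // onthTE.
  - by move=> i ib; rewrite hb // onthTE.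
  - by move=> i; rewrite -hda -hdb da db.
  - by rewrite -hea -heb da db.
exists (Arrow gP) => /=; last by rewrite da.
by split; rewrite /= ?da ?db.
Qed.

Local Notation triple := (seq (edge G) * vertex G * seq (edge G))%type.
Implicit Types t : triple.

Definition tmon t : lpa G K := mon K t.1.1 (vset1 t.1.2) t.2.
Definition tset t : set (arrow G) := mon_set t.1.1 (vset1 t.1.2) t.2.

(* A Cuntz-Krieger relation at v lengthens al, so it never relates two monomials
   of the same level. *)
Definition level N t : Prop := size t.1.1 = N \/
  (size t.1.1 < N)%N /\ infinite_set (emitted [set t.1.2]).

(** Only a finite emitter [v] with |al| = N needs work: it is regular as there are no sinks, so the
    Cuntz-Krieger relation lengthens both paths by an edge e, and p_{r(e)} splits over its
    vertices. *)
Lemma level_up N t : level N t ->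
  lin_span [set tmon u | u in level N.+1] (tmon t).
Proof.
case: t => [[al v] be] [/= alN|[/= alN iv]]; last first.
  by apply: lin_span_gen; exists (al, v, be) => //; right; rewrite ltnW.
case: (pselect (finite_set (emitted [set v]))) => [fv|iv]; last first.
  by apply: lin_span_gen; exists (al, v, be) => //; right; rewrite /= alN.
rewrite /tmon /= mon_ck; last by split => //; exact/set0P/eqP/no_sinks.
apply: lin_span_sum => e _; rewrite mon_sum; apply: lin_span_sum => w _.
apply: lin_span_gen; exists (al ++ [:: e], w, be ++ [:: e]) => //.
by left; rewrite /= size_cat addn1 alN.
Qed.

Lemma level_mono M N : (M <= N)%N ->
  lin_span [set tmon u | u in level M] `<=` lin_span [set tmon u | u in level N].
Proof.
move=> /subnK <-; elim: (N - M)%N => [//|d IH]; apply: subset_trans IH _.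
by apply: lin_span_sub => _ [t tN <-]; exact: level_up.
Qed.

Lemma level_span x : exists N, lin_span [set tmon u | u in level N] x.
Proof.
have := lpa_span x; move: x; apply: lin_span_ind.
- by exists 0%N; exact: lin_span0.
- move=> x y [M xM] [N yN]; exists (maxn M N); apply: lin_spanD.
    by apply: level_mono xM; exact: leq_maxl.
  by apply: level_mono yN; exact: leq_maxr.
- by move=> c x [N xN]; exists N; exact: lin_spanZ.
move=> _ [al [A [be ->]]]; exists (size al); rewrite mon_sum.
apply: lin_span_sum => v _; apply: lin_span_gen.
by exists (al, v, be) => //; left.
Qed.

(** The degree of [g] makes the second paths equally long too; prefixes of given length are unique,
    and the vertex is the source of the common tail. *)
Lemma tset_inj t u g : tset t g -> tset u g -> size t.1.1 = size u.1.1 -> t = u.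
Proof.
case: t u => [[al v] be] [[al' v'] be'] [/= pa pb _ av dg] [/= pa' pb' _ av' dg'] ss.
have <- := bpre_inj pa pa' ss; have <- // : be = be'.
  apply: bpre_inj pb pb' _; lia.
by congr (_, _, _); rewrite -[v]av -[v']av' ss.
Qed.

(** If the first path of [u] is strictly longer than that of [t], then the latter is shorter than
    [N], so its vertex is an infinite emitter and the witness of [mon_witness] ends right after it;
    [u] would require one more edge. Equal lengths are settled by [tset_inj]. *)
Lemma tmon_separated N t : level N t -> tmon t = 0 \/
  exists2 g, tset t g & forall u, level N u -> (size t.1.1 <= size u.1.1)%N ->
    tset u g -> u = t.
Proof.
move=> tN; have [|[g gt gi]] := mon_witness t.1.1 t.1.2 t.2; first by left.
right; exists g => // u uN tu ug; apply: (tset_inj ug gt); apply/eqP.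
rewrite eqn_leq tu andbT leqNgt; apply/negP => lt_tu.
case: tN => [tN|[tN /gi g0]]; first by case: uN => [|[]]; lia.
have [/= pu _ _ _ _] := ug; have [pt _ _ _ _] := gt.
have [_ h _] := bpreP pt; have [hu _ _] := bpreP pu.
by have := onthTE u.1.1 (size t.1.1); rewrite -hu // -[X in bnth _ X]addn0 -h g0 lt_tu.
Qed.

Lemma sum_fctE (I : Type) (r : seq I) (P : pred I) (c : I -> K)
    (F : I -> arrow G -> K^o) g :
  (\sum_(i <- r | P i) c i *: F i) g = \sum_(i <- r | P i) c i * F i g.
Proof. by rewrite fct_sumE. Qed.

Lemma level_free N (r : seq (K * triple)) : (forall q, q \in r -> level N q.2) ->
  \sum_(q <- r) q.1 *: lpa_repr (tmon q.2) = 0 -> \sum_(q <- r) q.1 *: tmon q.2 = 0.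
Proof.
have [n] := ubnP (size r); elim: n r => // n IH r rn rN r0.
have [->|[q1 q1r]] : r = [::] \/ exists q, q \in r.
- by case: (r) => [|q r']; [left|right; exists q; rewrite mem_head].
- by rewrite big_nil.
have [q0 q0r q0min] : exists2 q0, q0 \in r &
    forall q, q \in r -> (size q0.2.1.1 <= size q.2.1.1)%N.
  have hex : exists m, has (fun q : K * triple => size q.2.1.1 == m) r.
    by exists (size q1.2.1.1); apply/hasP; exists q1.
  case: (ex_minnP hex) => m /hasP[q0 q0r /eqP <-] mmin.
  by exists q0 => // q qr; apply: mmin; apply/hasP; exists q.
(* [r] may repeat a triple, so all entries with that of [q0] are collected into one coefficient
   [c]. *)
pose P (q : K * triple) := q.2 == q0.2.
pose c := \sum_(q <- r | P q) q.1.
have cE (M : lmodType K) (F : triple -> M) :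
    \sum_(q <- r | P q) q.1 *: F q.2 = c *: F q0.2.
  by rewrite scaler_suml; apply: eq_bigr => q /eqP ->.
have c0 : c *: tmon q0.2 = 0.
  have [->|[g gq0 gq]] := tmon_separated (rN _ q0r); first by rewrite scaler0.
  suff -> : c = 0 by rewrite scale0r.
  have := congr1 (fun h : arrow G -> K^o => h g) r0;
  rewrite sum_fctE (bigID P) /= [X in _ + X]big1_seq.
    rewrite addr0 => /(etrans _); apply; rewrite /c; apply: eq_bigr => q /eqP ->.
    by rewrite mon_repr indicE mem_set ?mulr1.
  move=> q /andP[qP qr]; rewrite mon_repr indicE memNset ?mulr0 // => qg.
  by move/eqP: qP; apply; apply: gq => //; [exact: rN|exact: q0min].
rewrite (bigID P) /= cE c0 add0r -big_filter; apply: IH.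
- rewrite -ltnS; apply: leq_trans rn; rewrite ltnS size_filter.
  rewrite -(count_predC P r) -[ltnLHS]add0n ltn_add2r.
  by rewrite -has_count; apply/hasP; exists q0; rewrite ?/P.
- by move=> q; rewrite mem_filter => /andP[_ /rN].
- move: r0; rewrite (bigID P) /= (cE _ (fun t => lpa_repr (tmon t))) -linearZ c0 linear0.
  rewrite add0r => r0.
  by rewrite big_filter; exact: r0.
Qed.

Lemma lpa_repr_inj : injective (@lpa_repr K G).
Proof.
apply: raddf_inj => x x0; have [N] := level_span x.
have rep : lin_span [set tmon u | u in level N] `<=`
    [set x | exists2 r : seq (K * triple),
    (forall q, q \in r -> level N q.2) & x = \sum_(q <- r) q.1 *: tmon q.2].
  apply: lin_span_ind => [|_ _ [r rN ->] [r' rN' ->]|d _ [r rN ->]|_ [t tN <-]].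
  - by exists [::]; rewrite ?big_nil.
  - exists (r ++ r'); last by rewrite big_cat.
    by move=> q; rewrite mem_cat => /orP[/rN|/rN'].
  - exists [seq (d * q.1, q.2) | q <- r]; first by move=> q /mapP[q' /rN ? ->].
    by rewrite big_map scaler_sumr; apply: eq_bigr => q _; rewrite scalerA.
  - exists [:: (1, t)]; last by rewrite big_seq1 scale1r.
    by move=> q; rewrite mem_seq1 => /eqP ->.
move=> /rep[r rN xE]; rewrite xE; apply: (level_free rN).
have {}x0 : lpa_repr x = 0 := x0.
by rewrite -[RHS]x0 xE [RHS]linear_sum; apply: eq_bigr => q _; rewrite linearZ.
Qed.

End Injectivity.

(** * Finite subcovers and cylinder sets *)

Lemma compact_finite_cover (T : topologicalType) (A : set T) (I : choiceType)
    (D : set I) (f : I -> set T) : compact A -> (forall i, D i -> open (f i)) ->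
  A `<=` cover D f -> finite_subset_cover D f A.
Proof.
move=> cA fo Af; case: (pselect (exists t : T, True)) => [[t _]|T0]; last first.
  by exists fset0 => // t; case: T0; exists t.
(* The library's [compact_cover] is stated for pointed spaces. *)
pose T' : ptopologicalType :=
  HB.pack (Topological.sort T) (isPointed.Build (Topological.sort T) t).
have : compact (A : set T') by [].
by rewrite compact_cover; apply.
Qed.

Section CylinderSets.
Variable G : ultragraph.
Implicit Types (a b : bpath G) (A B : vset G) (al be : seq (edge G)).
Implicit Types (x y z : ultrapath G).

Lemma starts_bpre x a : starts x a <->
  bpre (uedges x) a /\ vset_set (urng x) (bsrc (bdrop (ulen x) a)).
Proof.
split=> [[h ax]|[pa ax]].
  by have pa := bpre_nth h; split => //; apply: ax; rewrite bvert_bdrop.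
split; first by have [] := bpreP pa.
by rewrite bvert_bdrop // => _ ->.
Qed.

Lemma cyl_mon_set x y : urng x = urng y ->
  cyl x y = mon_set (uedges x) (urng x) (uedges y).
Proof.
move=> xy; apply/seteqP; split=> g.
  move=> /cylP[/starts_bpre[px vx] /starts_bpre[py _] ab eab dg]; split => //.
  have [_ hx ex] := bpreP px; have [_ hy ey] := bpreP py.
  by apply: bpath_ext => [i|]; rewrite ?hx ?hy ?ab // ex ey.
move=> [px py xyE vx dg]; apply/cylP.
have [_ hx ex] := bpreP px; have [_ hy ey] := bpreP py; split => //.
- exact/starts_bpre.
- by apply/starts_bpre; rewrite -xy /ulen -xyE.
- by move=> i; rewrite -hx -hy xyE.
- by rewrite -ex -ey xyE.
Qed.

Lemma bpre_sorted al a : bpre al a -> sorted (@consec G) al.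
Proof.
elim: al a => [//|e [//|f al] IH] a /andP[/eqP a0 pa].
have /= /andP[/eqP b0 _] := pa; apply/andP; split; last exact: (IH _ pa).
by apply/asboolP; rewrite -(bsrc_hd b0); exact: bsrc_tl a0.
Qed.

Lemma bpre_last e al a : bpre (e :: al) a ->
  erng (last e al) (bsrc (bdrop (size al).+1 a)).
Proof.
elim: al e a => [|f al IH] e a /andP[/eqP a0 pa]; first exact: bsrc_tl a0.
by rewrite bdropS; exact: IH.
Qed.

Definition rng_meet al A : vset G :=
  if al is e :: l then vsetI A (vrng (last e l)) else A.

Lemma rng_meet_sub al A : rng_meet al A `<=` A.
Proof. by case: al => //= e l w []. Qed.

(** An arrow in the set shows that [al] and [be] are paths. An ultrapath requires its vertex set to
    lie in the range of its last edge; cutting A down to both ranges loses nothing, as the source of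
    the tail lies in them. *)
Lemma mon_set_cyl al A be : mon_set al A be = set0 \/
  exists x y, [/\ urng x = urng y, uedges x = al, uedges y = be &
    mon_set al A be = cyl x y].
Proof.
case: (pselect (mon_set al A be = set0)) => [|/eqP/set0P[g [pa pb _ _ _]]].
  by left.
right; pose A' := rng_meet be (rng_meet al A).
have alA : ends_over al A'.
  rewrite /A'; case: (al) => //= e l; apply: subset_trans (@rng_meet_sub _ _) _.
  by move=> w [].
have beA : ends_over be A' by rewrite /A'; case: (be) => //= e l w [].
exists (UPath (bpre_sorted pa) alA), (UPath (bpre_sorted pb) beA); split => //.
rewrite cyl_mon_set //=; apply/seteqP; split=> h [ph qh hE hA hd]; split => //.
  have hl : vset_set (rng_meet al A) (bsrc (bdrop (size al) (arng h))).
    by case: (al) ph hA => //= e l ph hA; split => //; exact: bpre_last ph.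
  rewrite /A'; move: hl qh; rewrite hE; case: (be) => //= e l hl qh; split => //.
  exact: bpre_last qh.
exact: (rng_meet_sub (rng_meet_sub hA)).
Qed.

Definition cylinder : set (set (arrow G)) :=
  [set C | exists x y, urng x = urng y /\ C = cyl x y].

Lemma cylinder_mon_set al A be :
  mon_set al A be = set0 \/ cylinder (mon_set al A be).
Proof.
by have [|[x [y [xy _ _ ->]]]] := mon_set_cyl al A be; [left|right; exists x, y].
Qed.

(** If they share an arrow, the shorter pair of paths is a prefix of the longer one. Equal lengths
    give the cylinder over the intersected vertex sets; otherwise the cylinders are nested. *)
Lemma cylinderI C C' : cylinder C -> cylinder C' ->
  C `&` C' = set0 \/ cylinder (C `&` C').
Proof.
move=> [x [y [xy ->]]] [x' [y' [xy' ->]]].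
case: (pselect (cyl x y `&` cyl x' y' = set0)) => [|/eqP/set0P[g [gC gC']]].
  by left.
wlog xx' : x y xy x' y' xy' gC gC' / (ulen x <= ulen x')%N.
  move=> H; case: (leqP (ulen x) (ulen x')) => [|/ltnW] xx'; first exact: H.
  by rewrite setIC; exact: H.
have [[|e s] ss [x'E y'E es]] := cyl_len xy gC gC' (esym (subnKC xx')).
  rewrite !cats0 in x'E y'E; rewrite !cyl_mon_set // x'E y'E.
  have -> : mon_set (uedges x) (urng x) (uedges y) `&`
      mon_set (uedges x) (urng x') (uedges y) =
      mon_set (uedges x) (vsetI (urng x) (urng x')) (uedges y).
    apply/seteqP; split=> [h [[? ? ? ? ?] [? ? ? ? ?]] //|h [? ? ? [? ?] ?]].
    by split.
  exact: cylinder_mon_set.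
have [ex ey] := es _ _ erefl.
right; exists x', y'; split => //; apply/setIidPr.
by apply: (@cyl_prefix _ _ _ _ _ (e :: s)).
Qed.

Lemma cylinder_basic C : cylinder C -> basic C.
Proof.
move=> [x [y [xy ->]]]; exists x, y, set0, set0; split => //.
by rewrite /cylD !bigcup_set0 setU0 setD0.
Qed.

(** The partial product is single-valued, so at most one pair of products occurs in the union. *)
Lemma cylinder_mul x y z : urng x = urng y ->
  cyl_mul x y z = set0 \/ cylinder (cyl_mul x y z).
Proof.
move=> xy; case: (pselect (cyl_mul x y z = set0)) => [|/eqP/set0P]; first by left.
move=> [g [x' [y' [xx' yy' _]]]]; right; exists x', y'; split.
  by move: xx' yy' => [_] + [_]; case: (uedges z) => [|e l] [_ ->] [_ ->]; rewrite ?xy.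
have det w v v' : umul w z v -> umul w z v' -> v = v'.
  move=> [vE vr] [v'E v'r]; apply: upath_ext; first by rewrite vE v'E.
  by move: vr v'r; case: (uedges z) => [|e l] [_ ->] [_ ->].
apply/seteqP; split=> h; last by exists x', y'.
by move=> [x1 [y1 [/(det _ _ _ xx') <- /(det _ _ _ yy') <-]]].
Qed.

Lemma basic_open (U : set (arrow G)) : basic U -> open U.
Proof.
move=> bU; exists [set U]; first by move=> _ ->.
by rewrite bigcup_set1.
Qed.

Lemma open_basic (U : set (arrow G)) g : open U -> U g ->
  exists W, [/\ basic W, W g & W `<=` U].
Proof.
move=> [D Db <-] [W DW Wg]; exists W; split => //; first exact: Db.
exact: bigcup_sup.
Qed.

(** Range and source have fixed prefixes [x] and [y] and a common tail, so each determines the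
    other; the degree is constant. *)
Lemma cyl_bisection x y : bisection (ultragraph_groupoid G) (cyl x y).
Proof.
have ext (a b : bpath G) m : (forall i, (i < m)%N -> bnth a i = bnth b i) ->
    (forall i, bnth a (m + i) = bnth b (m + i)) -> bend a = bend b -> a = b.
  move=> h1 h2 ab; apply: bpath_ext => // i; case: (ltnP i m) => [/h1//|mi].
  by rewrite -(subnKC mi) h2.
split=> g h /set_mem/cylP[[gx _] [gy _] ge gb gd] /set_mem/cylP[[hx _] [hy _] he hb hd].
  move=> /aunit_inj gh; apply: arrow_inj => //; first by rewrite gd hd.
  apply: (ext _ _ (ulen y)); last by rewrite -gb -hb gh.
    by move=> i iy; rewrite gy ?hy.
  by move=> i; rewrite -ge -he gh.
move=> /aunit_inj gh; apply: arrow_inj => //; last by rewrite gd hd.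
apply: (ext _ _ (ulen x)); last by rewrite gb hb gh.
  by move=> i ix; rewrite gx ?hx.
by move=> i; rewrite ge he gh.
Qed.

End CylinderSets.

(** * Consequences of compactness: finite vertex sets, the range and the grading *)

Section Compactness.
Variable G : ultragraph.
Hypothesis no_sinks : forall v : vertex G, ~ sink v.
Hypothesis basic_compact : forall U : set (arrow G), basic U -> compact U.

Lemma cylinder_cob (C : set (arrow G)) :
  cylinder C -> compact_open_bisection (ultragraph_groupoid G) C.
Proof.
move=> cC; have bC := cylinder_basic cC; split; [exact: basic_compact| |].
  exact: basic_open.
by move: cC => [x [y [_ ->]]]; exact: cyl_bisection.
Qed.

(* The cylinder over A is the disjoint union of the cylinders over its points. *)
Lemma vset_finite (A : vset G) : finite_set A.
Proof.
pose c (B : vset G) := cyl (uvset B) (uvset B).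
have cE B a : c B (aunit a) <-> vset_set B (bsrc a).
  by rewrite /c cyl_mon_set //=; split=> [[]|].
have cb B : basic (c B) by apply: cylinder_basic; exists (uvset B), (uvset B).
have [v _||D DA cov] := @compact_finite_cover _ _ _ (vset_set A)
    (fun v => c (vset1 v)) (basic_compact (cb A)).
- exact/basic_open/cb.
- move=> g; rewrite /c cyl_mon_set //= => -[_ _ gE gA gd].
  by exists (bsrc (arng g)); rewrite ?cyl_mon_set.
apply: (@sub_finite_set _ _ [set` D]); last exact: finite_fset.
move=> v Av; have [a [av _]] := bpath_exists no_sinks v.
have [|w wD] := cov (aunit a); first by apply/cE; rewrite av.
by move=> /cE; rewrite av => ->.
Qed.

Variable K : fieldType.
Local Notation F := (arrow G -> K^o).

Definition cyl_span : set F := lin_span [set (\1_C : F) | C in @cylinder G].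

Lemma indic_set0 : (\1_(set0 : set (arrow G)) : F) = 0.
Proof. by apply/funext => g; rewrite indicE in_set0. Qed.

(** By bilinearity it suffices to multiply two indicators, which gives the indicator of an
    intersection of cylinders. Hence the sets whose indicator lies in the span form a ring of
    sets. *)
Lemma cyl_span_mul (f h : F) : cyl_span f -> cyl_span h ->
  cyl_span (fun g => f g * h g).
Proof.
have eta (u v : F) : u = v -> cyl_span u -> cyl_span v by move=> ->.
move=> Sf; move: h; apply: lin_span_ind => [|h1 h2 S1 S2|c h Sh|_ [C cC <-]].
- by apply: eta (lin_span0 _); apply/funext => g; rewrite mulr0.
- by apply: eta (lin_spanD S1 S2); apply/funext => g; rewrite mulrDr.
- by apply: eta (lin_spanZ c Sh); apply/funext => g; rewrite mulrCA.
move: f Sf; apply: lin_span_ind => [|h1 h2 S1 S2|c h Sh|_ [C' cC' <-]].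
- by apply: eta (lin_span0 _); apply/funext => g; rewrite mul0r.
- by apply: eta (lin_spanD S1 S2); apply/funext => g; rewrite mulrDl.
- by apply: eta (lin_spanZ c Sh); apply/funext => g; rewrite -mulrA.
apply: (@eta (\1_(C' `&` C))).
  by apply/funext => g; rewrite !indicE in_setI -natrM mulnb.
have [->|cCC] := cylinderI cC' cC; first by rewrite indic_set0; exact: lin_span0.
by apply: lin_span_gen; exists (C' `&` C).
Qed.

Definition cyl_set (U : set (arrow G)) : Prop := cyl_span (\1_U).

Lemma cyl_set0 : cyl_set set0.
Proof. by rewrite /cyl_set indic_set0; exact: lin_span0. Qed.

Lemma cyl_setD U W : cyl_set U -> cyl_set W -> cyl_set (U `\` W).
Proof.
move=> SU SW; rewrite /cyl_set.
suff -> : (\1_(U `\` W) : F) = \1_U - (fun g => \1_U g * \1_W g).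
  by apply: lin_spanB => //; exact: cyl_span_mul.
apply/funext => g; rewrite -[RHS]/(_ - _) !indicE in_setD.
by case: (g \in U); case: (g \in W); rewrite /= ?mulr1 ?mulr0 ?subrr ?subr0.
Qed.

Lemma cyl_setU U W : cyl_set U -> cyl_set W -> cyl_set (U `|` W).
Proof.
move=> SU SW; rewrite /cyl_set.
suff -> : (\1_(U `|` W) : F) = \1_(U `\` W) + \1_W.
  by apply: lin_spanD => //; exact: cyl_setD.
apply/funext => g; rewrite -[RHS]/(_ + _) !indicE in_setU in_setD.
by case: (g \in U); case: (g \in W); rewrite /= ?addr0 ?add0r.
Qed.

Lemma cyl_set_bigcup (D : set (set (arrow G))) : finite_set D ->
  (forall W, D W -> cyl_set W) -> cyl_set (\bigcup_(W in D) W).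
Proof.
move=> /finite_seqP[r ->] h; rewrite bigcup_seq.
by rewrite big_seq; apply: big_ind => //; [exact: cyl_set0|exact: cyl_setU].
Qed.

Lemma cylinder_cyl_set C : C = set0 \/ cylinder C -> cyl_set C.
Proof.
by move=> [->|cC]; [exact: cyl_set0|apply: lin_span_gen; exists C].
Qed.

Lemma basic_cyl_set U : basic U -> cyl_set U.
Proof.
move=> [x [y [P [Q [xy fP _ fQ ->]]]]]; rewrite /cylD.
apply: cyl_setD; first by apply: cylinder_cyl_set; right; exists x, y.
have bigcup T (R : set T) (f : T -> set (arrow G)) : finite_set R ->
    (forall z, cyl_set (f z)) -> cyl_set (\bigcup_(z in R) f z).
  move=> fR fS; rewrite -(bigcup_image R f id).
  by apply: cyl_set_bigcup => [|_ [z _ <-]]; [exact: finite_image|].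
by apply: cyl_setU; apply: bigcup => // z; exact/cylinder_cyl_set/cylinder_mul.
Qed.

(** Finitely many of the basic sets contained in U cover it, so U is their union. *)
Lemma compact_open_cyl_set U : compact U -> open U -> cyl_set U.
Proof.
move=> cU oU.
have [W [bW WU]||D DD cov] := @compact_finite_cover _ _ _
    [set W | basic W /\ W `<=` U] id cU.
- exact: basic_open.
- by move=> g /(open_basic oU)[W [bW Wg WU]]; exists W.
suff -> : U = \bigcup_(W in [set` D]) W.
  apply: cyl_set_bigcup; first exact: finite_fset.
  by move=> W /DD/set_mem[bW _]; exact: basic_cyl_set.
apply/seteqP; split=> [g /cov //|g [W /DD/set_mem[_ WU]]]; exact: WU.
Qed.

Lemma steinberg_cyl_span : steinberg K (ultragraph_groupoid G) = cyl_span.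
Proof.
apply/seteqP; split; apply: lin_span_sub.
  by move=> _ [U [cU oU _] <-]; exact: compact_open_cyl_set.
by move=> _ [C cC <-]; apply: lin_span_gen; exists C => //; exact: cylinder_cob.
Qed.

Lemma cyl_repr (x y : ultrapath G) : urng x = urng y ->
  lpa_repr (mon K (uedges x) (urng x) (uedges y)) = \1_(cyl x y).
Proof. by move=> xy; rewrite mon_repr cyl_mon_set. Qed.

Lemma lpa_repr_range : range (@lpa_repr K G) = steinberg K (ultragraph_groupoid G).
Proof.
rewrite steinberg_cyl_span.
have -> : range (@lpa_repr K G) = lin_span ((@lpa_repr K G) @` (@monomials K G)).
  rewrite -lin_span_linear; congr (_ @` _).
  by apply/seteqP; split=> // x _; exact: lpa_span.
apply/seteqP; split; apply: lin_span_sub.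
  move=> _ [_ [al [A [be ->]]] <-]; rewrite mon_repr.
  exact/cylinder_cyl_set/cylinder_mon_set.
move=> _ [_ [x [y [xy ->]]] <-]; rewrite -cyl_repr //.
apply: lin_span_gen; exists (mon K (uedges x) (urng x) (uedges y)) => //.
by exists (uedges x), (urng x), (uedges y).
Qed.

Definition fedges (p : Defs.fpath G) : seq (edge G) :=
  if p is FEdges e l _ then e :: l else [::].

(** A path of length 0 is a vertex set B: it contributes no edges, but its p_B merges with p_A. *)
Definition fmeet (p : Defs.fpath G) (A : vset G) : vset G :=
  if p is FVset B then vsetI B A else A.

Lemma lpa_path_mon (p q : Defs.fpath G) A :
  lpa_mul (lpa_mul (lpa_path K p) (lpa_p K A)) (lpa_path' K q) =
  mon K (fedges p) (fmeet q (fmeet p A)) (fedges q).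
Proof.
have foldl_s z y l : lpa_mul (foldl (fun x e => lpa_mul x (lpa_s K e)) z l) y =
    lpa_mul z (lmon l y).
  by elim: l z => //= e l IH z; rewrite IH lpa_mulA.
have foldl_s' z y l : lpa_mul y (foldl (fun x e => lpa_mul (lpa_s' K e) x) z l) =
    lpa_mul (rmon y l) z.
  by elim: l z => //= e l IH z; rewrite IH lpa_mulA.
rewrite -lpa_mulA /mon; have -> : lpa_mul (lpa_p K A) (lpa_path' K q) =
    rmon (lpa_p K (fmeet q A)) (fedges q).
  case: q => [B|e l el] /=; last by rewrite foldl_s'.
  by rewrite lpa_pI; congr lpa_p; apply: vset_inj; exact: setIC.
case: p => [B|e l el] /=; last by rewrite foldl_s.
rewrite mul_rmon lpa_pI; congr (rmon (lpa_p K _) _).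
by case: q => [C|//] /=; apply: vset_inj; rewrite /= setICA.
Qed.

(** The match abstracts over the sortedness proof, which in the nonempty case is the proof that
    [FEdges] expects. *)
Definition fpath_of (x : ultrapath G) : Defs.fpath G :=
  match uedges x as s return sorted (@consec G) s -> Defs.fpath G with
  | e :: l => @FEdges G e l
  | [::] => fun=> FVset (urng x)
  end (uedgesP x).

Lemma fpath_ofP x :
  fedges (fpath_of x) = uedges x /\ fmeet (fpath_of x) (urng x) = urng x.
Proof.
case: x => [[|e l] A sP AP] //=; split => //.
by apply: vset_inj; exact: setIid.
Qed.

Lemma flen_fedges (p : Defs.fpath G) : flen p = size (fedges p).
Proof. by case: p. Qed.

(** Monomials are homogeneous. Conversely an indicator of degree n is a combination of cylinders of
    various degrees, and truncating to degree n keeps only those of degree n. *)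
Lemma lpa_repr_graded n : (@lpa_repr K G) @` lpa_comp n =
  steinberg_comp K (ultragraph_groupoid G) (@adeg G) n.
Proof.
rewrite lin_span_linear; apply/seteqP; split.
  apply: lin_span_sub => _ [_ [p [q [A [pqn ->]]]] <-].
  rewrite lpa_path_mon /= mon_repr.
  have [->|cC] := cylinder_mon_set (fedges p) (fmeet q (fmeet p A)) (fedges q).
    by rewrite indic_set0; exact: lin_span0.
  apply: lin_span_gen.
  exists (mon_set (fedges p) (fmeet q (fmeet p A)) (fedges q)) => //.
  split; first exact: cylinder_cob.
  by move=> g [_ _ _ _ /= ->]; rewrite -!flen_fedges.
apply: lin_span_sub => _ [U [[cU oU _] Un] <-].
(* [proj] fixes the indicator of U, and fixes or kills each cylinder because the degree is constant
   on it. *)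
pose proj (f : F) : F := fun g => if adeg g == n then f g else 0.
set S := lin_span _.
suff h : cyl_span `<=` [set f | S (proj f)].
  suff <- : proj (\1_U) = \1_U by exact/h/compact_open_cyl_set.
  apply/funext => g; rewrite /proj; case: eqP => // gn.
  by rewrite indicE memNset // => /Un.
have eta (u v : F) : u = v -> S u -> S v by move=> ->.
apply: lin_span_ind => [|f1 f2 S1 S2|c f Sf|_ [_ [x [y [xy ->]]] <-]].
- apply: eta (lin_span0 _); apply/funext => g; rewrite /proj.
  by case: ifP.
- apply: eta (lin_spanD S1 S2); apply/funext => g; rewrite /proj -[LHS]/(_ + _).
  by case: ifP; rewrite ?addr0.
- apply: eta (lin_spanZ c Sf); apply/funext => g; rewrite /proj -[LHS]/(_ * _).
  by case: ifP; rewrite ?mulr0.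
have deg g : cyl x y g -> adeg g = (ulen x)%:Z - (ulen y)%:Z by move=> /cylP[].
have [xyn|xyn] := eqVneq ((ulen x)%:Z - (ulen y)%:Z) n; last first.
  apply: eta (lin_span0 _); apply/funext => g; rewrite /proj.
  case: eqP => // gn; rewrite indicE memNset // => /deg.
  by rewrite gn => nE; rewrite nE eqxx in xyn.
apply: (@eta (\1_(cyl x y))).
  apply/funext => g; rewrite /proj; case: eqP => // gn.
  by rewrite indicE memNset // => /deg; rewrite xyn.
rewrite -cyl_repr //; have [xE xA] := fpath_ofP x; have [yE yA] := fpath_ofP y.
apply: lin_span_gen; exists (mon K (uedges x) (urng x) (uedges y)) => //.
exists (fpath_of x), (fpath_of y), (urng x); split.
  by rewrite !flen_fedges xE yE.
by rewrite lpa_path_mon xE yE xA xy yA.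
Qed.

End Compactness.

Theorem theorem3p3 (K : fieldType) (G : ultragraph)
    (no_sinks : forall v : vertex G, ~ sink v)
    (basic_compact : forall U : set (arrow G), basic U -> compact U) :
  exists pi : {linear lpa G K -> (arrow G -> K^o)},
    [/\ (forall A : vset G,
           pi (lpa_p K A) = \1_(cyl (uvset A) (uvset A))),
        (forall e : edge G,
           pi (lpa_s K e) = \1_(cyl (uedge e) (uvset (vrng e)))) &
        (forall e : edge G,
           pi (lpa_s' K e) = \1_(cyl (uvset (vrng e)) (uedge e)))] /\
    [/\ (forall a b : lpa G K,
           pi (lpa_mul a b) = convolution (ultragraph_groupoid G) (pi a) (pi b)),
        injective pi,
        range pi = steinberg K (ultragraph_groupoid G) &
        (forall n : int,
           pi @` lpa_comp n =
           steinberg_comp K (ultragraph_groupoid G) (@adeg G) n)].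
Proof.
exists (@lpa_repr K G : {linear lpa G K -> (arrow G -> K^o)}); split.
  split=> [A|e|e].
  - exact: (@cyl_repr G K (uvset A) (uvset A)).
  (* s_e = s_e p_{r(e)} is the monomial of the pair (e, r(e)) and r(e), whose cylinder is the
     prescribed one. *)
  - by rewrite -mon_edge; exact: (@cyl_repr G K (uedge e) (uvset (vrng e))).
  - by rewrite -mon_edge'; exact: (@cyl_repr G K (uvset (vrng e)) (uedge e)).
split; first exact: lpa_repr_mul.
- exact/lpa_repr_inj/vset_finite.
- exact: lpa_repr_range.
- exact: lpa_repr_graded.
Qed.
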